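(* Let $b\in(0,3]$. Let $\mathbb{S}=\mathbb{R}/\mathbb{Z}$, identified with $[0,1)$. Given any $c_0\in\mathbb{R}\setminus\{0\}$ and any $\alpha,\beta\in(0,1)$ with $\alpha<\beta$, there exists $u_0\in C^\infty(\mathbb{S})$ with $u_0\not\equiv c_0$ and $$u_0(x)=c_0\quad\text{for all } x\in[\alpha,\beta],$$ such that the corresponding solution $u=u(x,t)$, defined on a time interval $[-T,T]$ with $T>0$, of the initial periodic boundary value problem on $\mathbb{S}$ $$\partial_t u+u\,\partial_x u+\partial_x(1-\partial_x^2)^{-1}\Big(\frac{b}{2}u^2+\frac{3-b}{2}(\partial_x u)^2\Big)=0,\qquad u(x,0)=u_0(x),$$ satisfies $$\partial_t u(x,0)=0\quad\text{for all } x\in[\alpha,\beta].$$ In particular, for every $t\in(-T,T)$ the function $u(\cdot,t)$ is not identically equal to $c_0$.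
   Context: $C^\infty(\mathbb{S})$ denotes the real-valued smooth $1$-periodic functions. $H^s(\mathbb{S})=(1-\partial_x^2)^{-s/2}L^2(\mathbb{S})$ is the periodic Sobolev space, and $W^{1,\infty}(\mathbb{S})$ is the space of Lipschitz functions on $\mathbb{S}$. The operator $(1-\partial_x^2)^{-1}$ is the inverse of $1-\partial_x^2$ on $1$-periodic functions, and $$\partial_x(1-\partial_x^2)^{-1}g(x)=\int_0^1\frac{\sinh(x-y-[x-y]-1/2)}{2\sinh(1/2)}\,g(y)\,dy,$$ where $[\cdot]$ denotes the greatest integer function. The equation in the claim is called the $b$-family of equations ($b=2$ is the Camassa-Holm equation, $b=3$ the Degasperis-Procesi equation). Corresponding solution: the following well-posedness facts are known and fix the meaning of ''the corresponding solution''. (i) For $s>3/2$ and any $u_0\in H^s(\mathbb{S})$ there exist $T=T(\|u_0\|_{H^s})>0$ and a unique solution $u\in C([-T,T]:H^s(\mathbb{S}))\cap C^1((-T,T):H^{s-1}(\mathbb{S}))$ of the initial periodic boundary value problem. (ii) For any $u_0\in X:=H^1(\mathbb{S})\cap W^{1,\infty}(\mathbb{S})$ there exist $T=T(\|u_0\|_X)>0$ and a unique solution $u\in C([-T,T]:H^1(\mathbb{S}))\cap C^1((-T,T):L^2(\mathbb{S}))\cap L^\infty([-T,T]:W^{1,\infty}(\mathbb{S}))$. Data $u_0\in C^\infty(\mathbb{S})$ lie in all these spaces, and the corresponding solution is the one in these classes (for any $s>3/2$), on its interval $[-T,T]$. The pointwise value $\partial_t u(x,0)$ refers to the continuous representative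 of $\partial_t u(\cdot,0)$. *)

(* Defs.v *)
From HB Require Import structures.
From mathcomp Require Import all_boot all_order all_algebra.
From mathcomp Require Import all_classical all_reals all_analysis.

Set Implicit Arguments.
Unset Strict Implicit.
Unset Printing Implicit Defensive.

Import Order.TTheory GRing.Theory Num.Theory.
Import numFieldNormedType.Exports.

Local Open Scope classical_set_scope.
Local Open Scope ring_scope.

(* Functions on the circle S = R/Z are 1-periodic functions R -> R, integrated
   over the period [0, 1].  Elements of L^2(S) are represented by functions,
   to be read up to almost everywhere equality.  Functions of time and space
   are curried as [u t x]. *)

Definition smooth_S {R : realType} (f : R -> R) : Prop :=
  periodic f 1 /\ forall (n : nat) (x : R), derivable (derive1n n f) x 1.

Definition L2_norm {R : realType} (f : R -> R) : \bar R :=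
  Lnorm (@lebesgue_measure R) 2%:E (EFin \o (f \_ `[0, 1]%classic)).

Definition L2_S {R : realType} : set (R -> R) :=
  [set f : R -> R | [/\ periodic f 1, measurable_fun setT f & (L2_norm f < +oo)%E]].

Definition fourier_cos {R : realType} (f : R -> R) (n : int) : R :=
  \int[@lebesgue_measure R]_(x in `[0, 1]) (f x * cos (2 * pi * n%:~R * x)).

Definition fourier_sin {R : realType} (f : R -> R) (n : int) : R :=
  \int[@lebesgue_measure R]_(x in `[0, 1]) (f x * sin (2 * pi * n%:~R * x)).

(* The L^2 norm of (1 - d_x^2)^(s/2) f, i.e. the square root of the sum over
   n in Z of (1 + (2 pi n)^2)^s |f^(n)|^2, where the squared modulus of the
   complex Fourier coefficient f^(n) of the real function f is split into its
   cosine and sine parts. *)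
Definition sobolev_norm {R : realType} (s : R) (f : R -> R) : \bar R :=
  poweR (\esum_(n in [set: int])
     ((1 + (2 * pi * n%:~R) ^+ 2) `^ s *
      (fourier_cos f n ^+ 2 + fourier_sin f n ^+ 2))%:E) 2^-1.

(* For s >= 0, where H^s(S) is a subspace of L^2(S). *)
Definition sobolev_S {R : realType} (s : R) : set (R -> R) :=
  [set f : R -> R | L2_S f /\ (sobolev_norm s f < +oo)%E].

(* max(sup norm, Lipschitz constant) <= M, for f continuous *)
Definition W1oo_bound {R : realType} (M : R) (f : R -> R) : Prop :=
  (forall x, `|f x| <= M) /\ M.-lipschitz f.

Definition weak_derivative {R : realType} (f g : R -> R) : Prop :=
  forall phi : R -> R, smooth_S phi ->
    \int[@lebesgue_measure R]_(x in `[0, 1]) (f x * derive1 phi x) =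
    - \int[@lebesgue_measure R]_(x in `[0, 1]) (g x * phi x).

Definition sinh {R : realType} (x : R) : R := (expR x - expR (- x)) / 2.

(* d_x (1 - d_x^2)^-1 g on 1-periodic functions *)
Definition dx_helmholtz_inv {R : realType} (g : R -> R) (x : R) : R :=
  \int[@lebesgue_measure R]_(y in `[0, 1])
    (sinh (x - y - (Num.floor (x - y))%:~R - 2^-1) / (2 * sinh 2^-1) * g y).

(* The b-family equation at a fixed time, for u = f and d_t u = ft. *)
Definition b_family_eq {R : realType} (b : R) (f ft : R -> R) : Prop :=
  exists fx : R -> R, [/\ L2_S fx, weak_derivative f fx &
    {ae @lebesgue_measure R, forall x,
      ft x + f x * fx x
      + dx_helmholtz_inv
          (fun y => b / 2 * f y ^+ 2 + (3 - b) / 2 * fx y ^+ 2) x = 0}].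

Definition continuous_in {R : realType} (N : (R -> R) -> \bar R) (A : set R)
    (u : R -> R -> R) : Prop :=
  forall t, A t ->
    (fun t' => N (fun x => u t' x - u t x)) @ within A (nbhs t) --> 0%E.

Definition derivative_in {R : realType} (N : (R -> R) -> \bar R)
    (u : R -> R -> R) (t : R) (v : R -> R) : Prop :=
  (fun h => N (fun x => h^-1 * (u (t + h) x - u t x) - v x)) @ 0^' --> 0%E.

(* u belongs to C([-T, T] : E1) /\ C^1((-T, T) : E0), with d_t u = ut, where
   N1 and N0 are the norms of E1 and E0. *)
Definition C0_C1 {R : realType} (T : R)
    (E1 : set (R -> R)) (N1 : (R -> R) -> \bar R)
    (E0 : set (R -> R)) (N0 : (R -> R) -> \bar R) (u ut : R -> R -> R) : Prop :=
  [/\ forall t, t \in `[- T, T] -> E1 (u t),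
      continuous_in N1 `[- T, T]%classic u,
      forall t, t \in `]- T, T[ -> E0 (ut t) /\ derivative_in N0 u t (ut t) &
      continuous_in N0 `]- T, T[%classic ut].

Definition class_Hs {R : realType} (s T : R) (u ut : R -> R -> R) : Prop :=
  C0_C1 T (sobolev_S s) (sobolev_norm s)
    (sobolev_S (s - 1)) (sobolev_norm (s - 1)) u ut.

Definition class_X {R : realType} (T : R) (u ut : R -> R -> R) : Prop :=
  C0_C1 T (sobolev_S 1) (sobolev_norm 1) L2_S L2_norm u ut /\
  exists M : R, {ae @lebesgue_measure R, forall t,
    t \in `[- T, T] -> W1oo_bound M (u t)}.

(* u is a solution on [-T, T] of the initial value problem with datum u0, in
   one of the classes where the problem is well posed, and ut is its time
   derivative (for each time in (-T, T), an L^2 function up to a.e. equality).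
   u t is the continuous representative of the Sobolev function u(., t). *)
Definition b_family_solution {R : realType} (b T : R) (u0 : R -> R)
    (u ut : R -> R -> R) : Prop :=
  [/\ (exists2 s : R, 3 / 2 < s & class_Hs s T u ut) \/ class_X T u ut,
      forall t, t \in `[- T, T] -> continuous (u t),
      forall x, u 0 x = u0 x &
      forall t, t \in `]- T, T[ -> b_family_eq b (u t) (ut t)].

(* Main.v *)
Require Import Defs.
From HB Require Import structures.
From mathcomp Require Import all_boot all_order all_algebra.
From mathcomp Require Import all_classical all_reals all_analysis.
From mathcomp Require Import measurable_realfun.
From mathcomp Require Import ring lra.
Set Implicit Arguments.
Unset Strict Implicit.
Unset Printing Implicit Defensive.
Import Order.TTheory GRing.Theory Num.Theory.
Import numFieldNormedType.Exports.
Local Open Scope classical_set_scope.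
Local Open Scope ring_scope.

(** The perturbation is local and the nonlocal term is balanced by hand.  Look
for u0 = c0 - lam * psi with psi a nonnegative smooth bump supported, modulo 1,
in the arc from beta to alpha + 1.  On the gap [alpha, beta] the transport term
vanishes, so d_t u(., 0) is there minus the nonlocal term D, the convolution of
the odd periodic kernel [kern] with the source
b/2 u0^2 + (3-b)/2 (u0')^2.  The constant b/2 c0^2 contributes nothing, because
the kernel has mean zero; the rest of the source vanishes on the gap.  There D
solves D'' = D, hence is a combination of its two end values
([dx_helmholtz_inv_gap]).  If psi is symmetric about the midpoint of its arc,
D is odd about the midpoint of the gap, so D(alpha) = - D(beta)
([dx_helmholtz_inv_reflect]).  It remains to obtain D(alpha) = D(beta).  This
difference is lam * (lam * B - b * c0 * A), where A and B integrate psi and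
b/2 psi^2 + (3-b)/2 (psi')^2 against the function
kern (beta - y) - kern (alpha - y), which is positive off the gap.  For
0 < b <= 3 both A and B are positive and lam = b * c0 * A / B is a nonzero
solution ([exists_balanced_amplitude]).

The bump is e (hump x), where e is the flat function exp (-1/x) and
hump x = sin (pi (x - a)) sin (pi (b - x)) is 1-periodic, positive exactly on
the arc from a to b modulo 1 and symmetric about its midpoint; periodicity and
smoothness thus come for free from composition.

The equation at time 0 determines d_t u(., 0) once the weak derivative of u0 is
known to be the classical one almost everywhere ([weak_derivative_smooth_ae]).

The function u(., t) never becomes the constant c0 because the mean over a
period is conserved ([mean_conserved]), and the mean of u0 is
c0 - lam * (mean of psi), which differs from c0.  Both norms in which u is
differentiable in time dominate the mean, so the mean of u has derivative the
mean of d_t u.  The latter is zero: the nonlocal term has mean zero by Fubini,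
and the mean of f f' vanishes for every continuous periodic f with weak
derivative f' ([Rintegral_mul_weak_derivative]).  For the last point, testing
the weak derivative against e (n * hump), which tends to the indicator of
]a, b[ while its derivative concentrates at the end points, shows that f is a
primitive of f' ([weak_derivative_primitive]); Fubini on a triangle
concludes. *)

(** * Smooth functions and the flat exponential *)

Section Smooth.
Context {R : realType}.
Implicit Types (f g df dg : R -> R) (n k : nat) (x : R).

Lemma is_derive1D f g x a b : is_derive x (1 : R) f a -> is_derive x (1 : R) g b ->
  is_derive x (1 : R) (fun y => f y + g y) (a + b).
Proof. by move=> fa gb; exact: is_deriveD. Qed.

Lemma is_derive1M f g x a b : is_derive x (1 : R) f a -> is_derive x (1 : R) g b ->
  is_derive x (1 : R) (fun y => f y * g y) (a * g x + f x * b).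
Proof.
move=> fa gb; have := is_deriveM fa gb => /is_derive_eq; apply.
by rewrite /GRing.scale /= addrC [g x * a]mulrC.
Qed.

(** Recursive form of n-fold differentiability: it lets smoothness be proved by
    induction on n from closure of the class under derivation. *)
Fixpoint derivable_upto n f : Prop :=
  if n is n'.+1 then (forall x, derivable f x 1) /\ derivable_upto n' (derive1 f)
  else True.

Lemma derivable_uptoS n f df : (forall x, is_derive x (1 : R) f (df x)) ->
  derivable_upto n df -> derivable_upto n.+1 f.
Proof.
move=> fdf ndf; split=> [x|]; first exact: ex_derive.
suff -> : derive1 f = df by [].
by apply/funext => x; rewrite derive1E; apply: derive_val.
Qed.

Lemma derivable_upto_is_derive n f : derivable_upto n.+1 f ->
  forall x, is_derive x (1 : R) f (derive1 f x).
Proof. by move=> [df _] x; apply: DeriveDef => //; rewrite derive1E. Qed.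

Lemma derivable_uptoW n f : derivable_upto n.+1 f -> derivable_upto n f.
Proof. by elim: n f => // n IH f [df /IH]. Qed.

Lemma derivable_upto_cst n (a : R) : derivable_upto n (fun=> a).
Proof.
elim: n a => // n IH a.
by apply: (@derivable_uptoS _ _ (fun=> 0)) => // x; exact: is_derive_cst.
Qed.

Lemma derivable_uptoD n f g : derivable_upto n f -> derivable_upto n g ->
  derivable_upto n (fun x => f x + g x).
Proof.
elim: n f g => // n IH f g nf ng.
have df := derivable_upto_is_derive nf; have dg := derivable_upto_is_derive ng.
apply: (derivable_uptoS (fun x => is_derive1D (df x) (dg x))).
by apply: IH; [case: nf|case: ng].
Qed.

Lemma derivable_uptoM n f g : derivable_upto n f -> derivable_upto n g ->
  derivable_upto n (fun x => f x * g x).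
Proof.
elim: n f g => // n IH f g nf ng.
have df := derivable_upto_is_derive nf; have dg := derivable_upto_is_derive ng.
apply: (derivable_uptoS (fun x => is_derive1M (df x) (dg x))).
by apply: derivable_uptoD; apply: IH;
  [case: nf|exact: derivable_uptoW|exact: derivable_uptoW|case: ng].
Qed.

Lemma derivable_upto_comp n f g : derivable_upto n f -> derivable_upto n g ->
  derivable_upto n (fun x => f (g x)).
Proof.
elim: n f g => // n IH f g nf ng.
have df := derivable_upto_is_derive nf; have dg := derivable_upto_is_derive ng.
apply: (derivable_uptoS (fun x => is_derive1_comp (df (g x)) (dg x))).
by apply: derivable_uptoM;
  [apply: IH; [case: nf|exact: derivable_uptoW]|case: ng].
Qed.

Lemma derivable_upto_affine n (a b : R) : derivable_upto n (fun x => a * x + b).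
Proof.
case: n => // n.
apply: (@derivable_uptoS _ _ (fun=> a)); last exact: derivable_upto_cst.
move=> x.
have dax : is_derive x (1 : R) (fun y => a * y) (0 * x + a * 1).
  by apply: is_derive1M.
have := is_derive1D dax (is_derive_cst b x 1) => /is_derive_eq; apply.
by rewrite mul0r add0r mulr1 addr0.
Qed.

Lemma derivable_upto_sin_cos n : derivable_upto n (@sin R) /\ derivable_upto n (@cos R).
Proof.
elim: n => // n [IHs IHc]; split.
  by apply: (derivable_uptoS (fun x => is_derive_sin x)).
apply: (@derivable_uptoS _ _ (fun x => -1 * sin x)).
  by move=> x; rewrite mulN1r; exact: is_derive_cos.
by apply: derivable_uptoM => //; exact: derivable_upto_cst.
Qed.

Lemma derivable_upto_smooth f : periodic f 1 -> (forall n, derivable_upto n f) ->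
  smooth_S f.
Proof.
move=> pf sf; split=> // n; move: (sf n.+1); rewrite /derive1n.
elim: n f {pf sf} => [|n IH] f; first by case.
by rewrite iterSr => -[_ /IH].
Qed.

(** The family x^(-k) exp (-1/x), extended by 0, is closed under derivation up to
    linear combinations; the case k = 0 is the flat function of the bumps. *)
Definition flat k x : R := if 0 < x then x^-1 ^+ k * expR (- x^-1) else 0.

Lemma flat_le0 k x : x <= 0 -> flat k x = 0.
Proof. by rewrite /flat ltNge => ->. Qed.

Lemma flat_ge0 k x : 0 <= flat k x.
Proof.
rewrite /flat; case: ifPn => // x0.
by rewrite mulr_ge0 ?expR_ge0// exprn_ge0// invr_ge0 ltW.
Qed.

(** From exp y >= y^(k+2) / (k+2)! at y = 1/x: flatness of second order at 0 is
    all that differentiability at 0 needs. *)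
Lemma flat_quadratic k x : flat k x <= (k.+2)`!%:R * x ^+ 2.
Proof.
rewrite /flat; case: ifPn => [x0|_]; last by rewrite mulr_ge0// sqr_ge0.
have y0 : 0 < x^-1 by rewrite invr_gt0.
have E : x^-1 ^+ k.+2 <= (k.+2)`!%:R * expR x^-1.
  rewrite mulrC -ler_pdivrMr ?ltr0n ?fact_gt0//.
  by apply: le_trans (expR_ge1Dxn k.+1 (ltW y0)); rewrite lerDr.
rewrite expRN -ler_pdivlMr ?invr_gt0 ?expR_gt0// invrK.
rewrite -mulrA [_ ^+ 2 * _]mulrC mulrA -ler_pdivrMr ?exprn_gt0//.
by rewrite -exprVn -exprD addn2.
Qed.

Lemma is_derive_quadratic f (C : R) : (forall x, `|f x| <= C * x ^+ 2) ->
  is_derive (0 : R) (1 : R) f 0.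
Proof.
move=> fC; have f0 : f 0 = 0.
  by apply/normr0_eq0/le_anti; rewrite normr_ge0 andbT (le_trans (fC 0))// expr0n mulr0.
apply/is_derive1_caratheodory; exists (fun z => f z / z); split => //.
- move=> z; rewrite f0 !subr0 /=; have [->|z0] := eqVneq z 0; first by rewrite f0 mulr0.
  by rewrite divfK.
- have bnd z : `|f z / z| <= C * `|z|.
    have [->|z0] := eqVneq z 0; first by rewrite f0 mul0r normr0 mulr0.
    rewrite normrM normfV ler_pdivrMr ?normr_gt0// -mulrA -expr2.
    by rewrite real_normK// num_real.
  have E : f 0 / 0 = 0 by rewrite f0 mul0r.
  suff H : f z / z @[z --> (0 : R)] --> f 0 / 0 by exact: H.
  rewrite E.
  apply/norm_cvg0P.
  apply: (@squeeze_cvgr _ _ _ _ (cst 0) (fun z => C * `|z|)).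
  + by near=> z; rewrite normr_ge0 bnd.
  + exact: cvg_cst.
  + have : C * `|z| @[z --> (0 : R)] --> C * `|0 : R|.
      by apply: cvgMr; apply: cvg_norm; exact: cvg_id.
    by rewrite normr0 mulr0.
- by rewrite f0 mul0r.
Unshelve. all: by end_near. Qed.

Lemma is_derive_flat k x : is_derive x (1 : R) (flat k) (-1 * (k%:R * flat k.+1 x) + flat k.+2 x).
Proof.
have [x0|x0|->] := ltgtP x 0.
- rewrite !flat_le0 ?(ltW x0)// !mulr0 addr0.
  apply: (@near_eq_is_derive _ _ _ (fun=> 0)).
  near=> y; rewrite flat_le0//.
  by near: y; apply: lt_le_nbhsl.
- rewrite /flat x0.
  pose F := fun y : R => y^-1 ^+ k * expR (- y^-1).
  apply: (@near_eq_is_derive _ _ _ F).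
    near=> y; rewrite ifT//.
    by near: y; apply: lt_nbhsr.
  have xn : x != 0 by rewrite gt_eqF.
  have dV : is_derive x (1 : R) (fun y : R => y^-1) (- x ^- 2).
    have := @is_deriveV R id x 1 1 xn (is_derive_id _ _) => /is_derive_eq; apply.
    by rewrite /GRing.scale /= mulr1.
  have d1 : is_derive x (1 : R) (fun y : R => y^-1 ^+ k) (k%:R * x^-1 ^+ k.-1 * - x ^- 2).
    by have := is_deriveX k dV; rewrite fctE /GRing.scale.
  have dN : is_derive x (1 : R) (fun y : R => - y^-1) (x ^- 2).
    by have := is_deriveN dV; rewrite opprK.
  have d2 : is_derive x (1 : R) (fun y : R => expR (- y^-1)) (expR (- x^-1) * x ^- 2).
    exact: (@is_derive1_comp R expR (fun y => - y^-1) x _ _ (is_derive_expR _) dN).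
  have := is_derive1M d1 d2 => /is_derive_eq; apply.
  rewrite -exprVn; move: (x^-1) (expR _) => y E.
  by case: k {F d1} => [|k] /=; rewrite ?exprS; ring.
- rewrite !flat_le0// !mulr0 addr0; apply: (@is_derive_quadratic _ (k.+2)`!%:R) => z.
  by rewrite ger0_norm ?flat_ge0// flat_quadratic.
Unshelve. all: by end_near. Qed.

(** Induction on n for all k at once, since the derivative involves the indices
    k + 1 and k + 2. *)
Lemma derivable_upto_flat n k : derivable_upto n (flat k).
Proof.
elim: n k => // n IH k; apply: derivable_uptoS (is_derive_flat k) _.
apply: derivable_uptoD => //; apply: derivable_uptoM; first exact: derivable_upto_cst.
by apply: derivable_uptoM => //; exact: derivable_upto_cst.
Qed.

End Smooth.

(** * Integrals over a period *)

Section CircleIntegrals.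
Context {R : realType}.
Local Notation mu := (@lebesgue_measure R).
Implicit Types (f g : R -> R) (a b c : R).

(** The reflected measure agrees with Lebesgue measure on intervals. Working with
    measures rather than substitutions admits discontinuous integrands, such as
    products with the kernel below. *)
Lemma lebesgue_measure_reflect c (A : set R) : measurable A ->
  mu [set y | A (c - y)] = mu A.
Proof.
move=> mA; apply/esym.
have mphi : measurable_fun setT (fun y : measurableTypeR R => c - y : measurableTypeR R).
  by apply: measurable_funB => //; exact: measurable_cst.
pose mphi' := isMeasurableFun.Build _ _ _ _ _ mphi.
pose phi : {mfun _ >-> _} := HB.pack (fun y : measurableTypeR R => c - y : measurableTypeR R) mphi'.
apply: (@lebesgue_measure_unique R (pushforward mu phi)) => // _ [[a b]] _ <-.
have E : phi @^-1` `]a, b]%classic = `[c - b, c - a[%classic.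
  by apply/seteqP; split => y /=; rewrite !in_itv/=; lra.
change (mu `]a, b] = mu (phi @^-1` `]a, b]%classic)); rewrite E.
rewrite !lebesgue_measure_itv/= !lte_fin -!EFinB.
have -> : (c - b < c - a) = (a < b) by lra.
have -> : c - a - (c - b) = b - a by lra.
by [].
Qed.

Lemma bounded_integrable f (M : R) (A : set R) : measurable A -> (mu A < +oo)%E ->
  measurable_fun A f -> (forall x, `|f x| <= M) -> mu.-integrable A (EFin \o f).
Proof.
move=> mA fA mf fM; apply: measurable_bounded_integrable => //.
exists M; split; first exact: num_real.
by move=> N MN x _; rewrite /= (le_trans (fM x))// ltW.
Qed.

Lemma bounded_integrable_itv f (M : R) a b : measurable_fun setT f ->
  (forall x, `|f x| <= M) -> mu.-integrable `[a, b] (EFin \o f).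
Proof.
move=> mf fM; apply: (@bounded_integrable f M) => //.
  by rewrite lebesgue_measure_itv/=; case: ifPn => _; rewrite ?ltry// -EFinB ltry.
exact: measurable_funS mf.
Qed.

Lemma Rintegral_reflect c a b f (M : R) : measurable_fun setT f ->
  (forall x, `|f x| <= M) ->
  \int[mu]_(y in `[c - b, c - a]) f (c - y) = \int[mu]_(y in `[a, b]) f y.
Proof.
move=> mf fM; congr fine.
pose phi (y : measurableTypeR R) : measurableTypeR R := c - y.
have mphi : measurable_fun setT phi.
  by apply: measurable_funB => //; exact: measurable_cst.
pose mphi' := isMeasurableFun.Build _ _ _ _ _ mphi.
pose phi' : {mfun _ >-> _} := HB.pack phi mphi'.
have E : `[c - b, c - a]%classic = phi @^-1` `[a, b]%classic.
  by apply/seteqP; split => y /=; rewrite /phi !in_itv/=; lra.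
rewrite E.
transitivity (\int[pushforward mu phi']_(y in `[a, b]) (f y)%:E)%E; last first.
  by apply: eq_measure_integral => A mA _; exact: lebesgue_measure_reflect.
rewrite (@integral_pushforward _ _ _ _ _ _ mphi mu _ (EFin \o f))//.
  by apply/measurable_EFinP.
rewrite -E; apply: (@bounded_integrable_itv (f \o phi) M) => //.
  exact: measurableT_comp.
by move=> x; exact: fM.
Qed.

Lemma Rintegral_split a c b f : a <= c -> c <= b ->
  mu.-integrable `[a, b] (EFin \o f) ->
  \int[mu]_(y in `[a, b]) f y =
  \int[mu]_(y in `[a, c]) f y + \int[mu]_(y in `[c, b]) f y.
Proof.
move=> ac cb intf.
have := @Rintegral_itvB R f (BLeft a) (BRight b) c intf.
rewrite !bnd_simp => /(_ ac cb)/eqP; rewrite subr_eq addrC => /eqP ->; congr (_ + _).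
rewrite Rintegral_itv_obnd_cbnd//.
by apply: integrableS intf => //; apply: subset_itvr; rewrite bnd_simp.
Qed.

Lemma periodic_int f (n : int) x : periodic f 1 -> f (x + n%:~R) = f x.
Proof.
move=> pf; case: n => n; last rewrite NegzE mulrNz.
  by rewrite -pmulrn; exact: (periodicn pf).
by rewrite -{2}(subrK (n.+1%:~R) x) -pmulrn; apply/esym; exact: (periodicn pf).
Qed.

(** Splitting at the fractional part of [c] turns the reflection of a period
    into reflections of its two pieces. *)
Lemma Rintegral_periodic_reflect c f (M : R) : measurable_fun setT f ->
  (forall x, `|f x| <= M) -> periodic f 1 ->
  \int[mu]_(y in `[0, 1]) f (c - y) = \int[mu]_(y in `[0, 1]) f y.
Proof.
move=> mf fM pf.
pose r := c - (Num.floor c)%:~R.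
have [r0 r1] : 0 <= r /\ r <= 1.
  by have := floor_itv c; rewrite /r intrD; lra.
have fr y : f (c - y) = f (r - y).
  by rewrite -(periodic_int (Num.floor c) (r - y) pf); congr f; rewrite /r; lra.
have fr1 y : f (c - y) = f (r + 1 - y).
  by rewrite fr -(periodic_int 1 (r - y) pf); congr f; rewrite /=; lra.
have mfc : measurable_fun setT (fun y : R => f (c - y)).
  apply: (@measurableT_comp _ _ _ _ _ _ f) => //.
  by apply: measurable_funB => //; exact: measurable_cst.
rewrite (@Rintegral_split 0 r 1)//; last exact: (@bounded_integrable_itv _ M).
rewrite [RHS](@Rintegral_split 0 r 1)//; last exact: (@bounded_integrable_itv _ M).
rewrite -(@Rintegral_reflect r 0 r f M)// -(@Rintegral_reflect (r + 1) r 1 f M)//.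
have -> : r - r = 0 by lra.
have -> : r + 1 - 1 = r by lra.
have -> : r + 1 - r = 1 by lra.
have -> : r - 0 = r by lra.
by congr (_ + _); apply: eq_Rintegral => y _.
Qed.

Lemma measurable_shift c (A : set R) : measurable A ->
  measurable [set y | A (y + c)].
Proof.
move=> mA.
have mphi : measurable_fun setT (fun y : measurableTypeR R => y + c : measurableTypeR R).
  by apply: measurable_funD => //; exact: measurable_cst.
by have := mphi measurableT _ mA; rewrite setTI.
Qed.

Lemma lebesgue_measure_shift c (A : set R) : measurable A ->
  mu [set y | A (y + c)] = mu A.
Proof.
move=> mA; rewrite -(lebesgue_measure_reflect 0 (measurable_shift c mA)) /=.
rewrite -(lebesgue_measure_reflect c mA); congr (mu _).
by apply/seteqP; split => y /=; rewrite sub0r addrC.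
Qed.

(** The line is a countable union of translates of the unit interval, and
    translates of null sets are null. *)
Lemma ae_periodic (P : R -> Prop) : (forall x, P (x + 1) = P x) ->
  {ae mu, forall x, x \in `[0, 1] -> P x} -> {ae mu, forall x, P x}.
Proof.
move=> pP [N [mN N0 PN]].
have pPn (n : nat) x : P (x + n%:R) = P x.
  elim: n => [|n IH]; first by rewrite addr0.
  by rewrite mulrSr addrA pP.
have shiftN c : mu.-negligible [set y | N (y + c)].
  exists [set y | N (y + c)]; split => //; first exact: measurable_shift.
  by rewrite lebesgue_measure_shift.
have : mu.-negligible (\bigcup_(n : nat)
    ([set y | N (y + - n%:R)] `|` [set y | N (y + n%:R)])).
  by apply: negligible_bigcup => n; exact: negligibleU.
apply: negligibleS => x /= nPx.
(* the union over n covers shifts by n and by - n; pick the sign of the floor *)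
have [k0|k0] := leP 0 (Num.floor x).
  exists `|Num.floor x|%N => //; left; apply: PN => /=.
  rewrite natr_absz ger0_norm// => /(_ _) H; apply: nPx.
  rewrite -(subrK (Num.floor x)%:~R x) -{2}(ger0_norm k0) -natr_absz pPn.
  by apply: H; rewrite in_itv/=; have := floor_itv x; rewrite intrD; lra.
exists `|Num.floor x|%N => //; right; apply: PN => /=.
rewrite natr_absz ltr0_norm// => /(_ _) H; apply: nPx.
rewrite -(pPn `|Num.floor x|%N) natr_absz ltr0_norm//.
by apply: H; rewrite in_itv/=; have := floor_itv x; rewrite intrD mulrNz; lra.
Qed.

(** A function vanishing almost everywhere cannot be positive on an interval of
    positive length. *)
Lemma Rintegral_gt0 a b c d f : a <= c -> c < d -> d <= b ->
  mu.-integrable `[a, b] (EFin \o f) ->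
  (forall x, x \in `[a, b] -> 0 <= f x) ->
  (forall x, x \in `]c, d[ -> 0 < f x) ->
  0 < \int[mu]_(x in `[a, b]) f x.
Proof.
move=> ac cd db intf f0 fpos.
rewrite lt_neqAle Rintegral_ge0// andbT eq_sym; apply/eqP => I0.
have mf : measurable_fun `[a, b]%classic (EFin \o f) by case/integrableP: intf.
have : (\int[mu]_(x in `[a, b]) `|(EFin \o f) x| = 0)%E.
  have -> : (\int[mu]_(x in `[a, b]) `|(EFin \o f) x| = \int[mu]_(x in `[a, b]) (f x)%:E)%E.
    by apply: eq_integral => x /[!inE] xab; rewrite /= ger0_norm// f0.
  rewrite -[LHS]fineK; last exact: integrable_fin_num.
  by rewrite -/(Rintegral _ _ _) I0.
move/(ae_eq_integral_abs mu (measurable_itv _) mf) => [N [mN N0 fN]].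
have : (mu `]c, d[ <= mu N)%E.
  apply: le_measure; rewrite ?inE//.
  move=> x /= xcd; apply: fN => /= H.
  have := fpos x xcd; have /H[->] : x \in `[a, b].
    by move: xcd; rewrite !in_itv/=; lra.
  by rewrite ltxx.
by rewrite N0 lebesgue_measure_itv/= lte_fin cd lee_fin subr_le0 leNgt cd.
Qed.

Lemma RintegralN (A : set R) f : measurable A -> mu.-integrable A (EFin \o f) ->
  \int[mu]_(x in A) (- f x) = - \int[mu]_(x in A) f x.
Proof.
move=> mA intf; rewrite -mulN1r -RintegralZl//.
by apply: eq_Rintegral => x _; rewrite mulN1r.
Qed.

Lemma Rintegral_dominated_cvg (A : set R) (f_ : nat -> R -> R) f g : measurable A ->
  (forall n, measurable_fun A (f_ n)) -> measurable_fun A f ->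
  {ae mu, forall x, A x -> f_ n x @[n --> \oo] --> f x} ->
  mu.-integrable A (EFin \o g) -> (forall n x, A x -> `|f_ n x| <= g x) ->
  \int[mu]_(x in A) f_ n x @[n --> \oo] --> \int[mu]_(x in A) f x.
Proof.
move=> mA mf_ mf cf intg f_g.
have [//||||/=] := @dominated_convergence _ _ R mu A mA (fun n => EFin \o f_ n)
    (EFin \o f) (EFin \o g) _ _ _ intg.
- by move=> n; apply/measurable_EFinP; exact: mf_.
- exact/measurable_EFinP.
- move: cf; apply: negligibleS => x /= nf fx; apply: nf => Ax.
  by apply: cvg_EFin; [exact: nearW|exact: fx].
- by apply: aeW => x n Ax /=; rewrite lee_fin; exact: f_g.
move=> intf _ H; apply: fine_cvg; rewrite fineK//.
exact: integrable_fin_num.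
Qed.

End CircleIntegrals.

(** * The kernel of d_x (1 - d_x^2)^-1 *)

Section Kernel.
Context {R : realType}.
Local Notation mu := (@lebesgue_measure R).
Implicit Types (f g : R -> R) (x y z : R).

Definition kern z : R :=
  Defs.sinh (z - (Num.floor z)%:~R - 2^-1) / (2 * Defs.sinh 2^-1).

Lemma sinhN z : Defs.sinh (- z) = - Defs.sinh z.
Proof. by rewrite /Defs.sinh opprK; lra. Qed.

Lemma lt_sinh : {mono (@Defs.sinh R) : x y / x < y}.
Proof.
apply: leW_mono; apply: le_mono => x y xy; rewrite /Defs.sinh.
by rewrite ltr_pM2r ?invr_gt0 ?ltr0n// ltrD// ?ltrN2 ltr_expR ?ltrN2.
Qed.

Lemma sinh_gt0 x : 0 < x -> 0 < Defs.sinh x.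
Proof.
move=> x0; have <- : Defs.sinh (0 : R) = 0 by rewrite /Defs.sinh oppr0 subrr mul0r.
by rewrite lt_sinh.
Qed.

Lemma sinh_half_gt0 : 0 < 2 * Defs.sinh (2^-1 : R).
Proof. by rewrite mulr_gt0// sinh_gt0// invr_gt0. Qed.

(** On each branch of the integer part the kernel is a translated hyperbolic sine:
    oddness, continuity and monotonicity are read off from this form. *)
Lemma kern_floor (n : int) z : n%:~R <= z < n%:~R + 1 ->
  kern z = Defs.sinh (z - n%:~R - 2^-1) / (2 * Defs.sinh 2^-1).
Proof. by move=> nz; rewrite /kern (@floor_def _ z n)// intrD. Qed.

Lemma kern_periodic : periodic kern 1.
Proof.
move=> z; rewrite /kern floorDrz ?int_num1// floor1 intrD.
by congr (Defs.sinh _ / _); lra.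
Qed.

Lemma kern_bounded z : `|kern z| <= 1.
Proof.
have h := sinh_half_gt0.
have := floor_itv z; rewrite intrD => fz.
rewrite /kern normrM normfV (gtr0_norm h) ler_pdivrMr// mul1r.
have [s1 s2] : - Defs.sinh (2^-1 : R) <= Defs.sinh (z - (Num.floor z)%:~R - 2^-1)
    /\ Defs.sinh (z - (Num.floor z)%:~R - 2^-1) <= Defs.sinh (2^-1 : R).
  by rewrite -sinhN; split; rewrite leNgt lt_sinh -leNgt; lra.
by rewrite ler_norml; lra.
Qed.

(** Oddness fails at the integers, where the kernel jumps. *)
Lemma kernN z : (Num.floor z)%:~R != z -> kern (- z) = - kern z.
Proof.
move=> nz; have := floor_itv z; rewrite intrD => fz.
rewrite (@kern_floor (- Num.floor z - 1)); last first.
  by rewrite intrD mulrNz; move: nz; rewrite neq_lt; lra.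
rewrite /kern -mulNr -sinhN intrD mulrNz; congr (Defs.sinh _ / _); lra.
Qed.

Lemma continuous_sinh : continuous (@Defs.sinh R).
Proof.
move=> x; apply: cvgMl; apply: cvgB; first exact: continuous_expR.
by apply: continuous_comp; [exact: opp_continuous|exact: continuous_expR].
Qed.

Lemma measurable_kern : measurable_fun setT kern.
Proof.
apply: measurable_funM; last exact: measurable_cst.
apply: (@measurableT_comp _ _ _ _ _ _ (@Defs.sinh R)).
  exact: continuous_measurable_fun continuous_sinh.
apply: measurable_funB; last exact: measurable_cst.
apply: measurable_funB; first exact: measurable_id.
apply: nondecreasing_measurable => //= x y xy.
by rewrite ler_int; exact: le_floor.
Qed.

Lemma continuous_kern z : (Num.floor z)%:~R != z -> kern x @[x --> z] --> kern z.
Proof.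
move=> nz; have := floor_itv z; rewrite intrD => fz.
pose n := Num.floor z.
pose F x := Defs.sinh (x - n%:~R - 2^-1) / (2 * Defs.sinh 2^-1).
have FK : {near z, F =1 kern}.
  near=> x; rewrite /F -kern_floor//.
  apply/andP; split.
    apply/ltW; near: x; apply: lt_nbhsr; move: nz; rewrite neq_lt /n; lra.
  by near: x; apply: lt_nbhsl; rewrite /n; lra.
have -> : kern z = F z by [].
apply: (cvg_trans (near_eq_cvg FK)).
apply: cvgMl; apply: (@continuous_comp _ _ _ (fun x => x - n%:~R - 2^-1) (@Defs.sinh R)).
  by apply: cvgB; [apply: cvgB; [exact: cvg_id|exact: cvg_cst]|exact: cvg_cst].
exact: continuous_sinh.
Unshelve. all: by end_near. Qed.

(** Only countably many points y put x - y on a jump. *)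
Lemma negligible_kern_jumps x : mu.-negligible [set y : R | (Num.floor (x - y))%:~R = x - y].
Proof.
pose A : set R := (fun n : int => x - n%:~R) @` [set: int].
have cA : countable A by exact: card_le_trans (card_image_le _ _) (countableP _).
apply: (@negligibleS _ _ _ mu A).
  by move=> y /= yE; exists (Num.floor (x - y)) => //; lra.
by exists A; split => //;
  [exact: countable_measurable|exact: countable_lebesgue_measure0].
Qed.

Lemma measurable_kern_shift x : measurable_fun setT (fun y : R => kern (x - y)).
Proof.
apply: (@measurableT_comp _ _ _ _ _ _ kern); first exact: measurable_kern.
by apply: measurable_funB => //; exact: measurable_cst.
Qed.

Lemma measurable_kern_center x : measurable_fun setT (fun y : R => kern (y - x)).
Proof.
apply: (@measurableT_comp _ _ _ _ _ _ kern); first exact: measurable_kern.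
by apply: measurable_funB => //; exact: measurable_cst.
Qed.

Lemma kernB x y : (Num.floor (x - y))%:~R != x - y -> kern (y - x) = - kern (x - y).
Proof. by move=> /kernN <-; rewrite opprB. Qed.

Lemma kern_mul_bounded g (M : R) x y : (forall z, `|g z| <= M) -> `|kern x * g y| <= M.
Proof.
by move=> gM; rewrite normrM -[M]mul1r ler_pM// ?kern_bounded.
Qed.

Lemma measurable_kern_mul g x : measurable_fun setT g ->
  measurable_fun setT (fun y : R => kern (x - y) * g y).
Proof. by move=> mg; apply: measurable_funM => //; exact: measurable_kern_shift. Qed.

Lemma integrable_kern_mul g (M : R) x : measurable_fun setT g -> (forall z, `|g z| <= M) ->
  mu.-integrable `[0, 1] (EFin \o (fun y => kern (x - y) * g y)).
Proof.
move=> mg gM; apply: (@bounded_integrable_itv _ _ M).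
  exact: measurable_kern_mul.
by move=> y; exact: kern_mul_bounded.
Qed.

(** Oddness of the kernel, whose exceptions are negligible. *)
Lemma Rintegral_kern_opp x g (M : R) : measurable_fun setT g -> (forall z, `|g z| <= M) ->
  \int[mu]_(y in `[0, 1]) (kern (y - x) * g y) =
  - \int[mu]_(y in `[0, 1]) (kern (x - y) * g y).
Proof.
move=> mg gM.
have mK : measurable_fun setT (fun y : R => kern (y - x) * g y).
  by apply: measurable_funM => //; exact: measurable_kern_center.
rewrite -RintegralN//; last exact: integrable_kern_mul.
congr fine; apply: ae_eq_integral => //.
- by apply/measurable_EFinP; exact: measurable_funS mK.
- apply/measurable_EFinP; apply: measurable_funN.
  by apply: (@measurable_funS _ _ _ _ setT) => //; exact: measurable_kern_mul.
- have := negligible_kern_jumps x; apply: negligibleS => y /= H.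
  apply/eqP; apply: contrapT => /negP/kernB E; apply: H => _.
  by rewrite E mulNr.
Qed.

(** The kernel is odd, and a period may be traversed in either direction. *)
Lemma Rintegral_kern_r x : \int[mu]_(y in `[0, 1]) kern (x - y) = 0.
Proof.
rewrite (Rintegral_periodic_reflect x measurable_kern kern_bounded kern_periodic).
have := @Rintegral_kern_opp 0 (fun=> 1) 1 (measurable_cst _) _.
rewrite normr1 => /(_ (fun _ => lexx _)).
have -> : \int[mu]_(y in `[0, 1]) (kern (y - 0) * 1) = \int[mu]_(y in `[0, 1]) kern y.
  by apply: eq_Rintegral => y _; rewrite subr0 mulr1.
have -> : \int[mu]_(y in `[0, 1]) (kern (0 - y) * 1) = \int[mu]_(y in `[0, 1]) kern y.
  rewrite -(Rintegral_periodic_reflect 0 measurable_kern kern_bounded kern_periodic).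
  by apply: eq_Rintegral => y _; rewrite mulr1.
lra.
Qed.

Lemma Rintegral_kern_l y : \int[mu]_(x in `[0, 1]) kern (x - y) = 0.
Proof.
have := @Rintegral_kern_opp y (fun=> 1) 1 (measurable_cst _) _.
rewrite normr1 => /(_ (fun _ => lexx _)).
under eq_Rintegral do rewrite mulr1.
move=> ->; under eq_Rintegral do rewrite mulr1.
by rewrite Rintegral_kern_r oppr0.
Qed.

Lemma dx_helmholtz_inv_periodic g : periodic (dx_helmholtz_inv g) 1.
Proof.
move=> x; apply: eq_Rintegral => y _; congr (_ * _).
have -> : x + 1 - y = x - y + 1 by lra.
exact: kern_periodic.
Qed.

(** An odd kernel turns functions symmetric about s/2 into functions
    antisymmetric about s/2. *)
Lemma dx_helmholtz_inv_reflect g (M s x : R) : measurable_fun setT g ->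
  (forall z, `|g z| <= M) -> periodic g 1 -> (forall z, g (s - z) = g z) ->
  dx_helmholtz_inv g (s - x) = - dx_helmholtz_inv g x.
Proof.
move=> mg gM pg sg.
transitivity (\int[mu]_(y in `[0, 1]) (kern (y - x) * g y)); last first.
  exact: Rintegral_kern_opp gM.
rewrite -(@Rintegral_periodic_reflect _ s _ M).
- apply: eq_Rintegral => y _; rewrite sg; congr (kern _ * _); lra.
- by apply: measurable_funM => //; exact: measurable_kern_center.
- by move=> y; exact: kern_mul_bounded.
- by move=> y; rewrite pg addrAC kern_periodic.
Qed.

(** Dominated convergence: for each x the kernel is continuous at x - y for
    almost every y. *)
Lemma continuous_dx_helmholtz_inv g (M : R) : measurable_fun setT g ->
  (forall z, `|g z| <= M) -> continuous (dx_helmholtz_inv g).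
Proof.
move=> mg gM x; apply/(@cvg_nbhsP _ R^o) => u ux.
apply: (@Rintegral_dominated_cvg _ _ (fun n y => kern (u n - y) * g y)
  (fun y => kern (x - y) * g y) (cst M)) => //.
- by move=> n; apply: measurable_funTS; exact: measurable_kern_mul.
- by apply: measurable_funTS; exact: measurable_kern_mul.
- have := negligible_kern_jumps x; apply: negligibleS => y /= H.
  apply/eqP; apply: contrapT => /negP E; apply: H => _.
  apply: cvgMl; apply: (@cvg_comp _ _ _ (fun n => u n - y) kern _ (nbhs (x - y))).
    by apply: cvgB => //; exact: cvg_cst.
  exact: continuous_kern.
- by apply: (@bounded_integrable_itv _ _ `|M|) => //=; exact: measurable_cst.
- by move=> n y _; exact: kern_mul_bounded.
Qed.

End Kernel.

(** * The nonlocal term has mean zero *)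

Section FubiniKernel.
Context {R : realType}.
Local Notation mu := (@lebesgue_measure R).
Implicit Types (g : R -> R) (x y z : R).
Local Notation I := (`[0, 1]%classic : set R).
Local Notation ind := (\1_I : R -> R).

Lemma Rintegral_indic (A : set R) g :
  \int[mu]_(x in A) g x = \int[mu]_x (\1_A x * g x).
Proof. by rewrite Rintegral_mkcond patch_indic; apply: eq_Rintegral => x _; rewrite mulrC. Qed.

Lemma integrable_indic (A : set R) g : measurable A ->
  mu.-integrable A (EFin \o g) <-> mu.-integrable setT (EFin \o (fun x => \1_A x * g x)).
Proof.
move=> mA; rewrite integrable_mkcond// restrict_EFin patch_indic.
rewrite (_ : (g \* \1_A)%R = (fun x => \1_A x * g x))//.
by apply/funext => x; rewrite /= mulrC.
Qed.

(** The integrand of the double integral, cut off to the unit square so that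
    Fubini can be used on the whole plane. *)
Definition kern2 g (p : R * R) : R := ind p.1 * kern (p.1 - p.2) * (ind p.2 * g p.2).

Lemma measurable_kern2 g : measurable_fun setT g -> measurable_fun setT (kern2 g).
Proof.
move=> mg; have mI : measurable_fun setT ind by exact: measurable_indic.
apply: measurable_funM; [apply: measurable_funM|apply: measurable_funM].
- exact: (measurableT_comp mI measurable_fst).
- apply: (measurableT_comp measurable_kern).
  by apply: measurable_funB; [exact: measurable_fst|exact: measurable_snd].
- exact: (measurableT_comp mI measurable_snd).
- exact: (measurableT_comp mg measurable_snd).
Qed.

Lemma integrable_tensor (p q : R -> R) : mu.-integrable setT (EFin \o p) ->
  mu.-integrable setT (EFin \o q) ->
  (mu \x mu)%E.-integrable setT (EFin \o (fun xy : R * R => p xy.1 * q xy.2)).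
Proof.
move=> ip iq.
have mp : measurable_fun setT p by apply/measurable_EFinP; case/integrableP: ip.
have mq : measurable_fun setT q by apply/measurable_EFinP; case/integrableP: iq.
apply/integrable21ltyP.
  apply/measurable_EFinP; apply: measurable_funM.
    exact: (measurableT_comp mp measurable_fst).
  exact: (measurableT_comp mq measurable_snd).
rewrite (_ : (\int[mu]_y _)%E = \int[mu]_y (`|(q y)%:E| * \int[mu]_x `|(p x)%:E|))%E; last first.
  apply: eq_integral => y _; rewrite -ge0_integralZl//; last first.
    by apply: measurableT_comp => //; apply/measurable_EFinP.
  by apply: eq_integral => x _; rewrite /= normrM mulrC EFinM.
rewrite ge0_integralZr//; [|by apply: measurableT_comp => //; apply/measurable_EFinP|
  exact: integral_ge0].
case/integrableP: ip => _ ip; case/integrableP: iq => _ iq.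
by apply: lte_mul_pinfty => //; [exact: integral_ge0|
  rewrite ge0_fin_numE// integral_ge0].
Qed.

(** The kernel is bounded, so a tensor product dominates. *)
Lemma integrable_kern2 g : measurable_fun setT g -> mu.-integrable I (EFin \o g) ->
  (mu \x mu)%E.-integrable setT (EFin \o kern2 g).
Proof.
move=> mg ig.
have i1 : mu.-integrable I (EFin \o (fun=> 1 : R)).
  by apply: (@bounded_integrable_itv _ _ 1) => // x; rewrite normr1.
have T := integrable_tensor ((integrable_indic _ (measurable_itv _)).1 i1)
  ((integrable_indic _ (measurable_itv _)).1 ig).
apply: (le_integrable _ _ _ T) => //.
  by apply/measurable_EFinP; exact: measurable_kern2.
move=> [x y] _; rewrite lee_fin /kern2 /= mulr1 [leLHS]normrM [leRHS]normrM.
rewrite ler_wpM2r// [leLHS]normrM ler_piMr//.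
exact: kern_bounded.
Qed.

Lemma fubini_F_kern2 g x : measurable_fun setT g -> mu.-integrable I (EFin \o g) ->
  fubini_F mu (EFin \o kern2 g) x = (ind x * dx_helmholtz_inv g x)%:E.
Proof.
move=> mg ig; rewrite /fubini_F.
have iK : mu.-integrable I (EFin \o (fun y => kern (x - y) * g y)).
  apply: (le_integrable _ _ _ ig) => //.
    by apply/measurable_EFinP; apply: measurable_funTS; exact: measurable_kern_mul.
  by move=> y _ /=; rewrite lee_fin normrM ler_piMl// kern_bounded.
have iK2 : mu.-integrable I (EFin \o (fun y => ind x * (kern (x - y) * g y))).
  have := integrableZl _ (ind x) iK; apply => //.
rewrite -[LHS]fineK; last first.
  apply: integrable_fin_num => //.
  move/integrable_indic: iK2 => /(_ (measurable_itv _)).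
  apply: eq_integrable => // y _ /=; rewrite /kern2/=; congr (_ %:E); ring.
congr (_%:E); rewrite -RintegralZl// Rintegral_indic; apply: eq_Rintegral => y _.
by rewrite /kern2 /= -/(kern (x - y)); ring.
Qed.

Lemma fubini_G_kern2 g y : fubini_G mu (EFin \o kern2 g) y = 0%E.
Proof.
rewrite /fubini_G.
have mk := measurable_kern_center y.
have iK : mu.-integrable I (EFin \o (fun x => kern (x - y))).
  by apply: (@bounded_integrable_itv _ _ 1) => // x; exact: kern_bounded.
have iK2 : mu.-integrable I (EFin \o (fun x => kern (x - y) * (ind y * g y))).
  by have := integrableZr _ (ind y * g y) iK; apply => //.
rewrite -[LHS]fineK; last first.
  apply: integrable_fin_num => //.
  move/integrable_indic: iK2 => /(_ (measurable_itv _)).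
  apply: eq_integrable => // x _ /=; rewrite /kern2/=; congr (_ %:E); ring.
congr (_%:E); transitivity (\int[mu]_(x in I) (kern (x - y) * (ind y * g y))).
  by rewrite Rintegral_indic; apply: eq_Rintegral => x _; rewrite /kern2 /= -mulrA.
by rewrite RintegralZr// Rintegral_kern_l mul0r.
Qed.

(** Exchange the order of integration: the kernel has mean zero in each
    variable. *)
Lemma Rintegral_dx_helmholtz_inv g : measurable_fun setT g -> mu.-integrable I (EFin \o g) ->
  mu.-integrable I (EFin \o dx_helmholtz_inv g) /\
  \int[mu]_(x in I) dx_helmholtz_inv g x = 0.
Proof.
move=> mg ig; have iK := integrable_kern2 mg ig; split.
  apply/integrable_indic => //.
  have := integrable_fubini_F iK; apply: eq_integrable => // x _.
  exact: fubini_F_kern2.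
rewrite Rintegral_indic /Rintegral.
under eq_integral do rewrite -fubini_F_kern2//.
have -> := Fubini iK.
transitivity (fine (\int[mu]_(y in [set: R]) (cst 0 y)))%E; last by rewrite integral0.
by congr fine; apply: eq_integral => y _; exact: fubini_G_kern2.
Qed.

End FubiniKernel.

(** * Periodic bumps *)

Section TestFunctions.
Context {R : realType}.
Implicit Types (f g h : R -> R) (a b x y z : R).

(** Each factor changes sign under x -> x + 1, so the product is periodic; its
    zeros modulo 1 are a and b. *)
Definition hump a b x : R := sin (pi * (x - a)) * sin (pi * (b - x)).

Lemma hump_periodic a b : periodic (hump a b) 1.
Proof.
move=> x; rewrite /hump.
have -> : pi * (x + 1 - a) = pi * (x - a) + pi by lra.
have -> : pi * (b - x) = pi * (b - (x + 1)) + pi by lra.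
by rewrite !sinDpi; lra.
Qed.

Lemma hump_reflect a b x : hump a b (a + b - x) = hump a b x.
Proof. by rewrite /hump mulrC; congr (sin (_ * _) * sin (_ * _)); lra. Qed.

Lemma sin_pi_ge0 x : 0 <= x <= 1 -> 0 <= sin (pi * x).
Proof. 
move=> x01; apply: sin_ge0_pi; rewrite mulr_ge0 ?pi_ge0//=; last by lra.
by rewrite ler_piMr ?pi_ge0//; lra.
Qed.

Lemma sin_pi_gt0 x : 0 < x < 1 -> 0 < sin (pi * x).
Proof. 
move=> x01; apply: sin_gt0_pi; rewrite mulr_gt0 ?pi_gt0//=; last by lra.
by rewrite gtr_pMr ?pi_gt0//; lra.
Qed.

Lemma hump_gt0 a b x : b <= a + 1 -> a < x < b -> 0 < hump a b x.
Proof. by move=> ab axb; rewrite mulr_gt0// sin_pi_gt0//; lra. Qed.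

Lemma hump_le0r a b x : a <= b -> b <= x <= a + 1 -> hump a b x <= 0.
Proof.
move=> ab bxa; have E : b - x = - (x - b) by lra.
rewrite /hump E mulrN sinN mulrN oppr_le0.
by rewrite mulr_ge0// sin_pi_ge0//; lra.
Qed.

Lemma hump_le0l a b x : a <= b -> b - 1 <= x <= a -> hump a b x <= 0.
Proof. by move=> ab bxa; rewrite -hump_reflect hump_le0r//; lra. Qed.

(** The product rule and the subtraction formula for the sine; in this form the
    derivative has a visible sign on each half of the arc. *)
Definition dhump a b x : R := pi * sin (pi * (a + b - 2 * x)).

Lemma is_derive_sin_affine (c d : R) x :
  is_derive x (1 : R) (fun y => sin (c * y + d)) (cos (c * x + d) * c).
Proof.
apply: (@is_derive1_comp R sin (fun y => c * y + d)).
have dc : is_derive x (1 : R) (fun y => c * y) (0 * x + c * 1) by apply: is_derive1M.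
have := is_derive1D dc (is_derive_cst d x 1) => /is_derive_eq; apply.
by rewrite mul0r add0r mulr1 addr0.
Qed.

Lemma is_derive_hump a b x : is_derive x (1 : R) (hump a b) (dhump a b x).
Proof.
have -> : hump a b = (fun y => sin (pi * y + - (pi * a)) * sin (- pi * y + pi * b)).
  by apply/funext => y; rewrite /hump; congr (sin _ * sin _); lra.
have := is_derive1M (is_derive_sin_affine pi (- (pi * a)) x)
  (is_derive_sin_affine (- pi) (pi * b) x) => /is_derive_eq; apply.
rewrite /dhump.
have -> : pi * (a + b - 2 * x) = (- pi * x + pi * b) - (pi * x + - (pi * a)) by lra.
by move: (- pi * x + _) (pi * x + _) => p q; rewrite sinB; ring.
Qed.

Lemma derivable_upto_hump n a b : derivable_upto n (hump a b).
Proof.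
have -> : hump a b = (fun y => sin (pi * y + - (pi * a)) * sin (- pi * y + pi * b)).
  by apply/funext => y; rewrite /hump; congr (sin _ * sin _); lra.
apply: derivable_uptoM.
  by apply: (derivable_upto_comp (f := sin)); [exact: (derivable_upto_sin_cos n).1|
    exact: derivable_upto_affine].
by apply: (derivable_upto_comp (f := sin)); [exact: (derivable_upto_sin_cos n).1|
    exact: derivable_upto_affine].
Qed.

(** As c tends to infinity this tends to the indicator of the arc from a to b; the
    value c = 1 serves for the initial datum. *)
Definition arc_bump a b (c : R) x : R := flat 0 (c * hump a b x).

Definition arc_dbump a b (c : R) x : R := flat 2 (c * hump a b x) * (c * dhump a b x).

Lemma bump_periodic a b c : periodic (arc_bump a b c) 1.
Proof. by move=> x; rewrite /arc_bump hump_periodic. Qed.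

Lemma derivable_upto_bump n a b c : derivable_upto n (arc_bump a b c).
Proof.
apply: (derivable_upto_comp (f := flat 0)); first exact: derivable_upto_flat.
by apply: derivable_uptoM; [exact: derivable_upto_cst|exact: derivable_upto_hump].
Qed.

Lemma bump_smooth a b c : smooth_S (arc_bump a b c).
Proof.
apply: derivable_upto_smooth; first exact: bump_periodic.
by move=> n; exact: derivable_upto_bump.
Qed.

Lemma is_derive_bump a b c x : is_derive x (1 : R) (arc_bump a b c) (arc_dbump a b c x).
Proof.
apply: (@is_derive1_comp R (flat 0) (fun y => c * hump a b y)).
  by have := is_derive_flat 0 (c * hump a b x); rewrite mul0r mulr0 add0r.
have := is_derive1M (is_derive_cst c x (1 : R)) (is_derive_hump a b x) => /is_derive_eq; apply.
by rewrite mul0r add0r.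
Qed.

Lemma derive1_bump a b c : derive1 (arc_bump a b c) = arc_dbump a b c.
Proof.
by apply/funext => x; rewrite derive1E; apply: derive_val; exact: is_derive_bump.
Qed.

Lemma bump_ge0 a b c x : 0 <= arc_bump a b c x.
Proof. exact: flat_ge0. Qed.

Lemma bump_le1 a b c x : arc_bump a b c x <= 1.
Proof.
rewrite /arc_bump /flat; case: ifPn => // h0.
by rewrite expr0 mul1r -expR0 ler_expR oppr_le0 invr_ge0 ltW.
Qed.

Lemma bump_eq0 a b c x : 0 <= c -> hump a b x <= 0 -> arc_bump a b c x = 0.
Proof. by move=> c0 h0; rewrite /arc_bump flat_le0// mulr_ge0_le0. Qed.

Lemma dbump_eq0 a b c x : 0 <= c -> hump a b x <= 0 -> arc_dbump a b c x = 0.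
Proof. by move=> c0 h0; rewrite /arc_dbump flat_le0 ?mul0r// mulr_ge0_le0. Qed.

Lemma bump_gt0 a b c x : 0 < c -> 0 < hump a b x -> 0 < arc_bump a b c x.
Proof. by move=> c0 h0; rewrite /arc_bump /flat mulr_gt0// mulr_gt0// expR_gt0. Qed.

Lemma dbump_ge0 a b c x : 0 <= c -> a + b - 1 <= 2 * x <= a + b -> 0 <= arc_dbump a b c x.
Proof.
move=> c0 xab; rewrite mulr_ge0 ?flat_ge0// mulr_ge0// mulr_ge0 ?pi_ge0//.
by rewrite sin_pi_ge0//; lra.
Qed.

Lemma dbump_le0 a b c x : 0 <= c -> a + b <= 2 * x <= a + b + 1 -> arc_dbump a b c x <= 0.
Proof.
move=> c0 xab; rewrite mulr_ge0_le0 ?flat_ge0// mulr_ge0_le0// mulr_ge0_le0 ?pi_ge0//.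
have -> : a + b - 2 * x = - (2 * x - (a + b)) by lra.
by rewrite mulrN sinN oppr_le0 sin_pi_ge0//; lra.
Qed.

Lemma bump_cvg1 a b x : 0 < hump a b x ->
  arc_bump a b n.+1%:R x @[n --> \oo] --> (1 : R).
Proof.
move=> h0; pose u (n : nat) : R := n.+1%:R.
have E : (fun n => arc_bump a b n.+1%:R x) = (fun n : nat => expR (- ((hump a b x)^-1 * n.+1%:R^-1))).
  apply/funext => n; rewrite /arc_bump /flat mulr_gt0// expr0 mul1r invfM.
  by rewrite mulrC.
have H : - ((hump a b x)^-1 * n.+1%:R^-1) @[n --> \oo] --> - ((hump a b x)^-1 * 0).
  by apply: cvgN; apply: cvgMr; exact: (@cvg_harmonic R).
rewrite mulr0 oppr0 in H.
rewrite E -[X in _ --> X]expR0.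
exact: (cvg_comp _ _ H (@continuous_expR R 0)).
Qed.

End TestFunctions.

(** * Integration of continuous functions *)

Section WeakPrimitive.
Context {R : realType}.
Local Notation mu := (@lebesgue_measure R).
Implicit Types (f g h : R -> R) (a b c d x y z : R).

Lemma is_derive_continuous f df : (forall x, is_derive x (1 : R) f (df x)) -> continuous f.
Proof.
move=> fdf x; apply: differentiable_continuous; apply/derivable1_diffP.
exact: ex_derive.
Qed.

Lemma smooth_is_derive f : smooth_S f -> forall x, is_derive x (1 : R) f (derive1 f x).
Proof. by move=> [_ sf] x; apply: DeriveDef; [exact: (sf 0%N)|rewrite derive1E]. Qed.

Lemma smooth_continuous f : smooth_S f -> continuous f.
Proof. by move=> /smooth_is_derive; exact: is_derive_continuous. Qed.

Lemma smooth_derive1 f : smooth_S f -> smooth_S (derive1 f).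
Proof.
move=> sf; split; last first.
  by case: sf => _ sf n x; have := sf n.+1 x; rewrite /derive1n iterSr.
move=> x; have d1 : is_derive x (1 : R) (fun y => y + 1) (1 + 0).
  exact: is_derive1D (is_derive_id _ _) (is_derive_cst _ _ _).
have d2 := @is_derive1_comp R f (fun y => y + 1) x _ _ (smooth_is_derive sf (x + 1)) d1.
have fE : f \o (fun y => y + 1) = f by apply/funext => y; exact: sf.1.
rewrite fE addr0 mulr1 in d2.
by rewrite [RHS]derive1E; apply/esym/derive_val.
Qed.

Lemma continuous_integrable a b f : continuous f -> mu.-integrable `[a, b] (EFin \o f).
Proof.
move=> cf; have H := @segment_compact R a b.
apply: continuous_compact_integrable => //.
exact: continuous_subspaceT.
Qed.

Lemma Rintegral_is_derive a b f df : a <= b -> (forall x, is_derive x (1 : R) f (df x)) ->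
  continuous df -> \int[mu]_(x in `[a, b]) df x = f b - f a.
Proof.
move=> + fdf cdf; rewrite le_eqVlt => /predU1P[->|ab].
  by rewrite set_itv1 Rintegral_set1 subrr.
have cf := is_derive_continuous fdf.
rewrite /Rintegral (@continuous_FTC2 _ _ f)//.
- exact: continuous_subspaceT.
- split; [by move=> x _; exact: ex_derive|..].
  + by apply: cvg_at_right_filter; exact: cf.
  + by apply: cvg_at_left_filter; exact: cf.
- by move=> x _; rewrite derive1E; apply: derive_val.
Qed.

Lemma continuous_bounded_itv a b f : a <= b -> continuous f ->
  exists M, forall x, x \in `[a, b] -> `|f x| <= M.
Proof.
move=> ab cf.
have [|c _ cM] := @EVT_max R (fun x => `|f x|) a b ab.
  by apply: continuous_subspaceT => x; apply: cvg_norm; exact: cf.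
by exists `|f c| => x /cM.
Qed.

Lemma continuous_mul f g : continuous f -> continuous g -> continuous (fun x => f x * g x).
Proof. by move=> cf cg x; apply: cvgM; [exact: cf|exact: cg]. Qed.

(** The density [dg] of a monotone [g] has mass [`|g d - g c|], so that testing
    against it gives back the value [K] up to the oscillation [E] of [f]. *)
Lemma Rintegral_monotone_density c d (K E s : R) f g dg : c <= d ->
  continuous f -> (forall x, is_derive x (1 : R) g (dg x)) -> continuous dg ->
  `|s| = 1 -> (forall x, x \in `[c, d] -> 0 <= s * dg x) ->
  (forall x, x \in `[c, d] -> `|f x - K| <= E) ->
  `|\int[mu]_(x in `[c, d]) (f x * dg x) - K * (g d - g c)| <= E * (s * (g d - g c)).
Proof.
move=> cd cf gdg cdg s1 sdg fK.
have cK : continuous (fun x => f x - K) by move=> x; apply: cvgB; [exact: cf|exact: cvg_cst].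
have iK := continuous_integrable c d (continuous_mul cK cdg).
have ig := continuous_integrable c d cdg.
have is_ : mu.-integrable `[c, d] (EFin \o (fun x => E * (s * dg x))).
  by apply: continuous_integrable => x; apply: cvgMr; apply: cvgMr; exact: cdg.
have -> : \int[mu]_(x in `[c, d]) (f x * dg x) - K * (g d - g c) =
    \int[mu]_(x in `[c, d]) ((f x - K) * dg x).
  rewrite -(Rintegral_is_derive cd gdg cdg) -RintegralZl// -RintegralB//.
  - by apply: eq_Rintegral => x _; rewrite mulrBl.
  - exact: continuous_integrable (continuous_mul cf cdg).
  - by apply: continuous_integrable => x; apply: cvgMr; exact: cdg.
have <- : \int[mu]_(x in `[c, d]) (E * (s * dg x)) = E * (s * (g d - g c)).
  rewrite -(Rintegral_is_derive cd gdg cdg) RintegralZl ?RintegralZl//.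
  by apply: continuous_integrable => x; apply: cvgMr; exact: cdg.
apply: (le_trans (le_normr_Rintegral _ iK)) => //.
apply: le_Rintegral => //.
  by apply: continuous_integrable => x; apply: cvg_norm; exact: (continuous_mul cK cdg).
move=> x xcd; rewrite normrM.
have -> : `|dg x| = s * dg x by rewrite -[RHS]ger0_norm ?sdg// normrM s1 mul1r.
by rewrite ler_wpM2r ?sdg// fK.
Qed.

End WeakPrimitive.

(** * Continuous functions are primitives of their weak derivatives *)

Section PrimitiveOfWeakDerivative.
Context {R : realType}.
Local Notation mu := (@lebesgue_measure R).
Implicit Types (f g h : R -> R) (a b c d x y z : R).

Lemma continuous_dbump a b c : continuous (arc_dbump a b c).
Proof. by rewrite -derive1_bump; apply/smooth_continuous/smooth_derive1/bump_smooth. Qed.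

Lemma hump_le0_unit a b x : 0 <= a -> a < b -> b <= 1 -> x \in `[0, 1] ->
  x \notin `]a, b[ -> hump a b x <= 0.
Proof.
move=> a0 ab b1; rewrite !in_itv/= => x01; rewrite negb_and -!leNgt => /orP[xa|bx].
  by apply: hump_le0l; lra.
by apply: hump_le0r; lra.
Qed.

(** Cut the period at a, a + d, the midpoint m, b - d and b. The bump increases
    from a to m and decreases from m to b, so for large c its derivative has mass
    close to 1 on [a, a + d], close to -1 on [b - d, b], and little in between. *)
Lemma bump_test_bound a b c d (M E : R) f : 0 <= a -> b <= 1 -> 0 < d -> 2 * d <= b - a ->
  0 <= c -> continuous f -> (forall x, x \in `[0, 1] -> `|f x| <= M) ->
  (forall x, x \in `[a, a + d] -> `|f x - f a| <= E) ->
  (forall x, x \in `[b - d, b] -> `|f x - f b| <= E) ->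
  `|\int[mu]_(x in `[0, 1]) (f x * arc_dbump a b c x) - (f a - f b)| <=
  2 * E + 2 * M * (2 - arc_bump a b c (a + d) - arc_bump a b c (b - d)).
Proof.
move=> a0 b1 d0 dab c0 cf fM fa fb.
pose m := (a + b) / 2.
have ifd u v : mu.-integrable `[u, v] (EFin \o (fun x => f x * arc_dbump a b c x)).
  by apply: continuous_integrable; apply: continuous_mul => //; exact: continuous_dbump.
have out u v : 0 <= u -> v <= 1 -> (v <= a \/ b <= u) ->
    \int[mu]_(x in `[u, v]) (f x * arc_dbump a b c x) = 0.
  move=> u0 v1 uv.
  have -> : \int[mu]_(x in `[u, v]) (f x * arc_dbump a b c x) = \int[mu]_(x in `[u, v]) (cst 0 x).
    apply: eq_Rintegral => x; rewrite inE/= in_itv/= => xuv.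
    rewrite dbump_eq0 ?mulr0//; apply: hump_le0_unit => //; first by lra.
      by rewrite in_itv/=; lra.
    by rewrite in_itv/=; case: uv => ?; rewrite negb_and -!leNgt; lra.
  by rewrite Rintegral_cst// mul0r.
have [am dm bm bd] : [/\ a <= a + d, a + d <= m, m <= b - d & b - d <= b].
  by clear -d0 dab; rewrite /m; split; lra.
have in01 x : a <= x -> x <= b -> x \in `[0, 1].
  by move=> ax xb; rewrite in_itv/= (le_trans a0 ax) (le_trans xb b1).
have pos x : a <= x -> x <= m -> 0 <= 1 * arc_dbump a b c x.
  move=> ax xm; rewrite mul1r dbump_ge0//; move: xm ax.
  by clear -a0 b1; rewrite /m; lra.
have neg x : m <= x -> x <= b -> 0 <= -1 * arc_dbump a b c x.
  move=> mx xb; rewrite mulN1r oppr_ge0 dbump_le0//; move: mx xb.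
  by clear -a0 b1; rewrite /m; lra.
have split5 : \int[mu]_(x in `[0, 1]) (f x * arc_dbump a b c x) =
    \int[mu]_(x in `[a, a + d]) (f x * arc_dbump a b c x) +
    (\int[mu]_(x in `[a + d, m]) (f x * arc_dbump a b c x) +
    (\int[mu]_(x in `[m, b - d]) (f x * arc_dbump a b c x) +
     \int[mu]_(x in `[b - d, b]) (f x * arc_dbump a b c x))).
  have m1 : m <= 1 by apply: le_trans bm (le_trans bd b1).
  have ad1 := le_trans dm m1.
  rewrite (@Rintegral_split _ 0 a 1)//; last exact: le_trans am ad1.
  rewrite (@Rintegral_split _ a (a + d) 1)//.
  rewrite (@Rintegral_split _ (a + d) m 1)//.
  rewrite (@Rintegral_split _ m (b - d) 1)//; last exact: le_trans bd b1.
  rewrite (@Rintegral_split _ (b - d) b 1)//.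
  rewrite (out 0 a)//; [|exact: le_trans am ad1|by left].
  rewrite (out b 1)//; [|by apply: le_trans a0 _; exact: le_trans (le_trans am dm) (le_trans bm bd)|by right].
  by rewrite add0r addr0.
have b_ge0 := @bump_ge0 R a b c; have b_le1 := @bump_le1 R a b c.
have ba0 : arc_bump a b c a = 0.
  apply: bump_eq0 => //; apply: hump_le0l; clear -b1 d0 dab a0; lra.
have bb0 : arc_bump a b c b = 0.
  apply: bump_eq0 => //; apply: hump_le0r; clear -b1 d0 dab a0; lra.
have M0 : 0 <= M by apply: le_trans (fM 0 _) => //; rewrite in_itv/= lexx ler01.
have E0 : 0 <= E by apply: le_trans (fa a _) => //; rewrite in_itv/= lexx.
have mon u v K D (s : R) (uv : u <= v) := @Rintegral_monotone_density R u v K D s f _ _ uv cf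
  (is_derive_bump a b c) (@continuous_dbump a b c).
have I1 : `|\int[mu]_(x in `[a, a + d]) (f x * arc_dbump a b c x) - f a * arc_bump a b c (a + d)| <= E.
  have := mon a (a + d) (f a) E 1 am (normr1 _) _ fa.
  rewrite ba0 subr0 mul1r => H; apply: (le_trans (H _)); last by rewrite ler_piMr.
  by move=> x; rewrite in_itv/= => /andP[ax xd]; exact: pos ax (le_trans xd dm).
have I2 : `|\int[mu]_(x in `[a + d, m]) (f x * arc_dbump a b c x)| <= M * (1 - arc_bump a b c (a + d)).
  have := mon (a + d) m 0 M 1 dm (normr1 _) _ _.
  rewrite mul0r subr0 mul1r => H; apply: (le_trans (H _ _)).
  - by move=> x; rewrite in_itv/= => /andP[dx xm]; exact: pos (le_trans am dx) xm.
  - move=> x; rewrite in_itv/= => /andP[dx xm]; rewrite subr0 fM//.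
    exact: in01 (le_trans am dx) (le_trans xm (le_trans bm bd)).
  - by rewrite ler_wpM2l// lerB.
have I3 : `|\int[mu]_(x in `[m, b - d]) (f x * arc_dbump a b c x)| <= M * (1 - arc_bump a b c (b - d)).
  have := mon m (b - d) 0 M (-1) bm (normrN1 _) _ _.
  rewrite mul0r subr0 mulN1r opprB => H; apply: (le_trans (H _ _)).
  - by move=> x; rewrite in_itv/= => /andP[mx xd]; exact: neg mx (le_trans xd bd).
  - move=> x; rewrite in_itv/= => /andP[mx xd]; rewrite subr0 fM//.
    exact: in01 (le_trans (le_trans am dm) mx) (le_trans xd bd).
  - by rewrite ler_wpM2l// lerB.
have I4 : `|\int[mu]_(x in `[b - d, b]) (f x * arc_dbump a b c x) + f b * arc_bump a b c (b - d)| <= E.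
  have := mon (b - d) b (f b) E (-1) bd (normrN1 _) _ fb.
  rewrite bb0 sub0r mulrN mulN1r !opprK => H; apply: (le_trans (H _)); last by rewrite ler_piMr.
  by move=> x; rewrite in_itv/= => /andP[dx xb]; exact: neg (le_trans bm dx) xb.
have fA : `|f a * (1 - arc_bump a b c (a + d))| <= M * (1 - arc_bump a b c (a + d)).
  rewrite normrM [X in _ * X]ger0_norm ?subr_ge0// ler_wpM2r ?subr_ge0// fM//.
  exact: in01 (lexx a) (le_trans (le_trans am dm) (le_trans bm bd)).
have fB : `|f b * (1 - arc_bump a b c (b - d))| <= M * (1 - arc_bump a b c (b - d)).
  rewrite normrM [X in _ * X]ger0_norm ?subr_ge0// ler_wpM2r ?subr_ge0// fM//.
  exact: in01 (le_trans (le_trans am dm) (le_trans bm bd)) (lexx b).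
rewrite split5; move: I1 I2 I3 I4 fA fB; rewrite !ler_norml; clear; lra.
Qed.

Lemma weak_derivative_bump_cvg f a b : continuous f -> 0 <= a -> a < b -> b <= 1 ->
  \int[mu]_(x in `[0, 1]) (f x * arc_dbump a b n.+1%:R x) @[n --> \oo] --> f a - f b.
Proof.
move=> cf a0 ab b1; apply/cvgrPdist_le => e e0.
have [M fM] := @continuous_bounded_itv R 0 1 f ler01 cf.
have M0 : 0 <= M by apply: le_trans (fM 0 _) => //; rewrite in_itv/= lexx ler01.
have e4 : 0 < e / 4 by lra.
have /cvgrPdist_le/(_ _ e4)/nbhs_ballP[d1 /= d10 fa] := cf a.
have /cvgrPdist_le/(_ _ e4)/nbhs_ballP[d2 /= d20 fb] := cf b.
(* halving keeps a + d and b - d on their own sides of the midpoint *)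
pose d := Num.min (Num.min d1 d2) (b - a) / 2.
have d0 : 0 < d by rewrite divr_gt0// !lt_min d10 d20/=; lra.
have [dd1 [dd2 dd3]] : 2 * d <= d1 /\ 2 * d <= d2 /\ 2 * d <= b - a.
  have : 2 * d <= Num.min (Num.min d1 d2) (b - a) by rewrite /d; lra.
  by rewrite !le_min => /andP[/andP[]].
have h1 : 0 < hump a b (a + d) by apply: hump_gt0; lra.
have h2 : 0 < hump a b (b - d) by apply: hump_gt0; lra.
(* the two end errors give e / 2, the four boundary defects the other e / 2;
   M + 1 avoids a division by zero *)
have e8 : 0 < e / (8 * (M + 1)) by rewrite divr_gt0// mulr_gt0//; lra.
have /cvgrPdist_le/(_ _ e8) B1 := bump_cvg1 h1.
have /cvgrPdist_le/(_ _ e8) B2 := bump_cvg1 h2.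
near=> n.
rewrite distrC.
have := @bump_test_bound a b n.+1%:R d M (e / 4) f a0 b1 d0 dd3 (ler0n _ _) cf fM _ _.
move=> H; apply: (le_trans (H _ _)).
- move=> x; rewrite in_itv/= => xa; rewrite distrC; apply: fa.
  by rewrite /ball/= distrC ger0_norm; move: xa d0 dd1; clear; lra.
- move=> x; rewrite in_itv/= => xb; rewrite distrC; apply: fb.
  by rewrite /ball/= ger0_norm; move: xb d0 dd2; clear; lra.
have b1n : 1 - arc_bump a b n.+1%:R (a + d) <= e / (8 * (M + 1)).
  by apply: le_trans (ler_norm _) _; near: n; exact: B1.
have b2n : 1 - arc_bump a b n.+1%:R (b - d) <= e / (8 * (M + 1)).
  by apply: le_trans (ler_norm _) _; near: n; exact: B2.
have : 2 * M * (2 - arc_bump a b n.+1%:R (a + d) - arc_bump a b n.+1%:R (b - d)) <=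
    2 * (M + 1) * (2 * (e / (8 * (M + 1)))).
  have b1' := bump_le1 a b n.+1%:R (a + d); have b2' := bump_le1 a b n.+1%:R (b - d).
  by rewrite ler_pM//; move: M0 b1' b2' b1n b2n; clear; lra.
have -> : 2 * (M + 1) * (2 * (e / (8 * (M + 1)))) = e / 2.
  by field; rewrite gt_eqF//; move: M0; clear; lra.
clear; lra.
Unshelve. all: by end_near. Qed.

(** Dominated convergence, the bumps being bounded by 1. *)
Lemma Rintegral_bump_cvg h a b : measurable_fun setT h ->
  mu.-integrable `[0, 1] (EFin \o h) -> 0 <= a -> a < b -> b <= 1 ->
  \int[mu]_(x in `[0, 1]) (h x * arc_bump a b n.+1%:R x) @[n --> \oo] -->
  \int[mu]_(x in `[a, b]) h x.
Proof.
move=> mh ih a0 ab b1.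
have -> : \int[mu]_(x in `[a, b]) h x = \int[mu]_(x in `[0, 1]) (h \_ `]a, b[) x.
  rewrite -Rintegral_mkcondr (_ : `[0, 1] `&` `]a, b[ = `]a, b[)%classic; last first.
    by apply/seteqP; split => x /=; rewrite !in_itv/=; [case|split; lra].
  congr fine; apply: integral_itv_bndoo; apply/measurable_EFinP.
  exact: measurable_funTS.
apply: (@Rintegral_dominated_cvg _ _ (fun n x => h x * arc_bump a b n.+1%:R x) _ (fun x => `|h x|)) => //.
- move=> n; apply: measurable_funTS; apply: measurable_funM => //.
  by apply: continuous_measurable_fun; apply: smooth_continuous; exact: bump_smooth.
- apply: measurable_funTS; rewrite -measurable_restrictT//.
  exact: measurable_funTS.
- apply: aeW => x x01; rewrite patchE; case: ifPn => [|xab].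
    rewrite inE/= in_itv/= => xab; rewrite -[X in _ --> X]mulr1; apply: cvgMr.
    by apply: bump_cvg1; apply: hump_gt0 => //; lra.
  have E : (fun n : nat => h x * arc_bump a b n.+1%:R x) = (fun=> 0).
    apply/funext => n; rewrite bump_eq0 ?mulr0//; apply: hump_le0_unit => //.
    by move: xab; rewrite notin_setE => /negP.
  by rewrite E; exact: cvg_cst.
- by have := integrable_norm ih.
- move=> n x _; rewrite normrM ler_piMr// ger0_norm ?bump_ge0//.
  exact: bump_le1.
Qed.

(** Test against bumps converging to the indicator of [a, b]: their derivatives
    converge to the difference of the point masses at a and b. *)
Lemma weak_derivative_primitive f h a b : continuous f -> measurable_fun setT h ->
  mu.-integrable `[0, 1] (EFin \o h) -> weak_derivative f h ->
  0 <= a -> a <= b -> b <= 1 -> \int[mu]_(x in `[a, b]) h x = f b - f a.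
Proof.
move=> cf mh ih fh a0 + b1; rewrite le_eqVlt => /predU1P[->|ab].
  by rewrite set_itv1 Rintegral_set1 subrr.
have H1 := weak_derivative_bump_cvg cf a0 ab b1.
have H2 := Rintegral_bump_cvg mh ih a0 ab b1.
have E : (fun n => \int[mu]_(x in `[0, 1]) (f x * arc_dbump a b n.+1%:R x)) =
    (fun n => - \int[mu]_(x in `[0, 1]) (h x * arc_bump a b n.+1%:R x)).
  by apply/funext => n; rewrite -fh ?derive1_bump//; exact: bump_smooth.
rewrite E in H1; have U := cvg_unique _ H1 (cvgN H2).
have {U}/(congr1 -%R) : f a - f b = - \int[mu]_(x in `[a, b]) h x by exact: U.
by rewrite opprB opprK.
Qed.

End PrimitiveOfWeakDerivative.

(** * The mean of f f' *)

Section WeakConsequences.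
Context {R : realType}.
Local Notation mu := (@lebesgue_measure R).
Implicit Types (f g h p : R -> R) (a b c d x y z : R).
Local Notation I := (`[0, 1]%classic : set R).

Definition triangle p (xy : R * R) : R := if xy.2 <= xy.1 then p xy.1 * p xy.2 else 0.

Lemma integrable_triangle p : mu.-integrable setT (EFin \o p) ->
  (mu \x mu)%E.-integrable setT (EFin \o triangle p).
Proof.
move=> ip; have mp : measurable_fun setT p by apply/measurable_EFinP; case/integrableP: ip.
apply: (le_integrable _ _ _ (integrable_tensor ip ip)) => //; last first.
  move=> [x y] _; rewrite lee_fin /triangle /=; case: ifP => // _.
  by rewrite normr0.
apply/measurable_EFinP; apply: measurable_fun_ifT; last exact: measurable_cst.
  by apply: measurable_fun_ler; [exact: measurable_snd|exact: measurable_fst].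
apply: measurable_funM.
  exact: (measurableT_comp mp measurable_fst).
exact: (measurableT_comp mp measurable_snd).
Qed.

(** A slice of the triangle is an interval, outside of which the integrand is 0. *)
Lemma fubini_triangle_slice h (q : R -> R) c u v : 0 <= u -> v <= 1 ->
  mu.-integrable I (EFin \o h) ->
  (forall y, q y = if y \in `[u, v] then c * h y else 0) ->
  (\int[mu]_y (q y)%:E)%E = (c * \int[mu]_(y in `[u, v]) h y)%:E.
Proof.
move=> u0 v1 ih qE.
have ih' : mu.-integrable `[u, v] (EFin \o h).
  by apply: integrableS ih => //; apply: subset_itv; rewrite bnd_simp.
have ich : mu.-integrable `[u, v] (EFin \o (fun y => c * h y)).
  by have := integrableZl _ c ih'; apply.
rewrite -RintegralZl// /Rintegral fineK; last exact: integrable_fin_num.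
rewrite [RHS]integral_mkcond; apply: eq_integral => y _.
by rewrite qE patchE mem_setE; case: ifP.
Qed.

(** By Fubini on the triangle [y <= x] the integral of [h * (f - f 0)] equals
    its opposite. *)
Lemma Rintegral_mul_weak_derivative f h : continuous f -> periodic f 1 ->
  measurable_fun setT h -> mu.-integrable I (EFin \o h) -> weak_derivative f h ->
  \int[mu]_(x in I) (f x * h x) = 0.
Proof.
move=> cf pf mh ih fh.
have f10 : f 1 = f 0 by rewrite -[1]add0r pf.
have prim := weak_derivative_primitive cf mh ih fh.
pose p x := \1_I x * h x.
have ip : mu.-integrable setT (EFin \o p) by exact: (integrable_indic _ (measurable_itv _)).1.
have pE x : p x = if x \in `[0, 1] then h x else 0.
  by rewrite /p indicE mem_setE; case: ifP => _; rewrite ?mul1r ?mul0r.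
have FE x : fubini_F mu (EFin \o triangle p) x = (p x * (f x - f 0))%:E.
  have [x01|x01] := boolP (x \in `[0, 1]); last first.
    rewrite pE (negbTE x01) mul0r /fubini_F -[RHS](integral0 mu setT).
    by apply: eq_integral => y _; rewrite /= /triangle /= pE (negbTE x01) mul0r if_same.
  have /andP[x0 x1] : 0 <= x <= 1 by rewrite in_itv/= in x01.
  rewrite -prim//; apply: (@fubini_triangle_slice h (fun y => triangle p (x, y)) (p x) 0 x) => // y.
  rewrite /triangle /= [p y]pE !in_itv/=.
  have [yx|xy] := leP y x; last by rewrite andbF.
  by rewrite (le_trans yx x1) andbT/=; case: ifP; rewrite ?mulr0.
have GE y : fubini_G mu (EFin \o triangle p) y = (p y * (f 0 - f y))%:E.
  have [y01|y01] := boolP (y \in `[0, 1]); last first.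
    rewrite pE (negbTE y01) mul0r /fubini_G -[RHS](integral0 mu setT).
    by apply: eq_integral => x _; rewrite /= /triangle /= [p y]pE (negbTE y01) mulr0 if_same.
  have /andP[y0 y1] : 0 <= y <= 1 by rewrite in_itv/= in y01.
  rewrite -f10 -prim//; apply: (@fubini_triangle_slice h (fun x => triangle p (x, y)) (p y) y 1) => // x.
  rewrite /triangle /= [p x]pE !in_itv/=.
  have [yx|xy] := leP y x; last by [].
  by rewrite (le_trans y0 yx)/=; case: ifP; rewrite ?mul0r// mulrC.
have [M fM] := @continuous_bounded_itv R 0 1 f ler01 cf.
have ifh : mu.-integrable I (EFin \o (fun x => f x * h x)).
  have iMh : mu.-integrable I (EFin \o (fun x => M * h x)).
    by have := integrableZl _ M ih; apply.
  apply: (le_integrable _ _ _ iMh) => //.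
    apply/measurable_EFinP; apply: measurable_funTS; apply: measurable_funM => //.
    exact: continuous_measurable_fun.
  move=> x xI /=; rewrite lee_fin !normrM ler_wpM2r//.
  by apply: le_trans (fM _ xI) (ler_norm _).
have ic : mu.-integrable I (EFin \o (fun x => f 0 * h x)).
  by have := integrableZl _ (f 0) ih; apply.
have J : \int[mu]_(x in I) (f x * h x - f 0 * h x) = \int[mu]_(x in I) (f 0 * h x - f x * h x).
  rewrite [LHS]Rintegral_indic [RHS]Rintegral_indic /Rintegral.
  transitivity (fine (\int[mu]_x fubini_F mu (EFin \o triangle p) x)%E).
    congr fine; apply: eq_integral => x _; rewrite FE /p; congr (_%:E); ring.
  transitivity (fine (\int[mu]_x fubini_G mu (EFin \o triangle p) x)%E).
    have FT := Fubini (integrable_triangle ip).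
    by rewrite /fubini_F /fubini_G FT.
  congr fine; apply: eq_integral => x _; rewrite GE /p; congr (_%:E); ring.
move: J; rewrite !RintegralB// RintegralZl// prim// f10 subrr mulr0; lra.
Qed.

End WeakConsequences.

(** * Norms dominating the mean *)

Section Norms.
Context {R : realType}.
Local Notation mu := (@lebesgue_measure R).
Implicit Types (f g h v : R -> R) (x y z : R).
Local Notation I := (`[0, 1]%classic : set R).

(** Hoelder against the indicator of the period, whose L^2 norm is 1. *)
Lemma integral_abs_le_L2_norm v : measurable_fun setT v ->
  (\int[mu]_(x in I) `|v x|%:E <= L2_norm v)%E.
Proof.
move=> mv.
have mvI : measurable_fun setT (v \_ I).
  by apply/(measurable_restrictT _ _).1 => //; exact: measurable_funTS.
have m1I : measurable_fun setT (\1_I : R -> R) by exact: measurable_indic.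
have mI : mu I = 1%E by rewrite lebesgue_measure_itv/= lte_fin ltr01 -EFinB subr0.
have h2 : (2^-1 + 2^-1 = 1 :> R) by lra.
have := @hoelder _ _ R mu (v \_ I) (\1_I) 2 2 mvI m1I (ltr0n _ 2) (ltr0n _ 2) h2.
have -> : Lnorm mu 2%:E (EFin \o (\1_I : R -> R)) = 1%E.
  rewrite unlock /Lnorm (_ : (\int[mu]_x _)%E = 1%E); first by rewrite poweR1r.
  rewrite -mI -[X in _ = mu X](setIT I) -integral_indic//; apply: eq_integral => x _ /=.
  rewrite indicE; case: (x \in I); rewrite ?normr1 ?normr0 ?poweR_EFin ?powR1//.
  by rewrite powR0.
rewrite mule1 Lnorm1; apply: le_trans.
rewrite [leLHS]integral_mkcond le_eqVlt; apply/orP; left; apply/eqP.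
apply: eq_integral => x _; rewrite /= !patchE indicE.
by case: (x \in I); rewrite ?mulr1 ?mulr0 ?normr0.
Qed.

Lemma L2_integrable v : measurable_fun setT v -> (L2_norm v < +oo)%E ->
  mu.-integrable I (EFin \o v).
Proof.
move=> mv L2v; apply/integrableP; split.
  by apply/measurable_EFinP; exact: measurable_funTS.
exact: le_lt_trans (integral_abs_le_L2_norm mv) L2v.
Qed.

Lemma L2_sqr_integrable v : measurable_fun setT v -> (L2_norm v < +oo)%E ->
  mu.-integrable I (EFin \o (fun x => v x ^+ 2)).
Proof.
move=> mv L2v; apply/integrableP; split.
  by apply/measurable_EFinP; apply: measurable_funTS; exact: measurable_funX.
have : (L2_norm v `^ 2 < +oo)%E by exact: poweR_lty.
rewrite /L2_norm poweR_Lnorm//; apply: le_lt_trans.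
rewrite [leLHS]integral_mkcond le_eqVlt; apply/orP; left; apply/eqP.
apply: eq_integral => x _; rewrite /= !patchE.
case: (x \in I); rewrite ?normr0 ?poweR_EFin ?powR0//=.
by rewrite powR_mulrn// normrX.
Qed.

Lemma mean_le_L2_norm v : measurable_fun setT v ->
  (`|\int[mu]_(x in I) v x|%:E <= L2_norm v)%E.
Proof.
move=> mv; have [->|L2v] := eqVneq (L2_norm v) +oo%E; first by rewrite leey.
have iv : mu.-integrable I (EFin \o v) by apply: L2_integrable => //; rewrite ltey.
rewrite EFin_normr_Rintegral//; apply: le_trans (integral_abs_le_L2_norm mv).
by apply: le_abse_integral => //; case/integrableP: iv.
Qed.

(** The mean is the Fourier mode of frequency zero. *)
Lemma mean_le_sobolev_norm (s : R) v : (`|\int[mu]_(x in I) v x|%:E <= sobolev_norm s v)%E.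
Proof.
pose A := (\int[mu]_(x in I) v x).
have fc : fourier_cos v 0 = A.
  by apply: eq_Rintegral => x _; rewrite mulr0z mulr0 mul0r cos0 mulr1.
have fs : fourier_sin v 0 = 0.
  rewrite /fourier_sin; under eq_Rintegral do rewrite mulr0z mulr0 mul0r sin0 mulr0.
  by rewrite Rintegral_cst// mul0r.
have : ((A ^+ 2)%:E <= \esum_(n in [set: int])
     ((1 + (2 * pi * n%:~R) ^+ 2) `^ s *
      (fourier_cos v n ^+ 2 + fourier_sin v n ^+ 2))%:E)%E.
  apply: esum_ge; exists [set 0]; first exact: (conj (finite_set1 _)).
  rewrite fsbig_set1 fc fs mulr0z mulr0 expr0n addr0 powR1 mul1r.
  by rewrite /= addr0.
move=> H; rewrite /sobolev_norm.
have -> : `|A|%:E = ((A ^+ 2)%:E `^ 2^-1)%E.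
  by rewrite poweR_EFin powR12_sqrt ?sqr_ge0// sqrtr_sqr.
have A0 : (0 <= (A ^+ 2)%:E)%E by rewrite lee_fin sqr_ge0.
apply: gt0_ler_poweR => //.
  by rewrite in_itv/= A0 leey.
by rewrite in_itv/= (le_trans A0 H) leey.
Qed.

End Norms.

(** * Time derivative of the mean *)

Section MeanConservation.
Context {R : realType}.
Local Notation mu := (@lebesgue_measure R).
Implicit Types (f g h v : R -> R) (x y z t : R).
Local Notation I := (`[0, 1]%classic : set R).

(** Lebesgue differentiation of the primitive: the integral of h up to x is
    f x - f 0, and f is differentiable. *)
Lemma weak_derivative_smooth_ae f h : smooth_S f -> measurable_fun setT h ->
  periodic h 1 -> mu.-integrable I (EFin \o h) -> weak_derivative f h ->
  {ae mu, forall x, h x = derive1 f x}.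
Proof.
move=> sf mh ph ih fh.
have cf := smooth_continuous sf.
apply: ae_periodic; first by move=> x; rewrite ph (smooth_derive1 sf).1.
pose g := h \_ I.
have ig : mu.-integrable setT (EFin \o g).
  by rewrite -restrict_EFin; move: ih; rewrite integrable_mkcond.
have igy y : mu.-integrable [set` Interval (BLeft 0) (BRight y)] (EFin \o g).
  exact: integrableS ig.
have lg : locally_integrable setT g by exact: integrable_locally.
have H := FTC1 igy lg.
have N1 (r : R) : mu.-negligible [set r].
  by exists [set r]; split => //; exact: lebesgue_measure_set1.
have N01 : mu.-negligible ([set 0] `|` [set 1]) by exact: negligibleU.
have := negligibleU H N01; apply: negligibleS => x /= nP.
have [->|x0] := eqVneq x 0; first by right; left.
have [->|x1] := eqVneq x 1; first by right; right.
left => /= Hx; apply: nP; rewrite in_itv/= => /andP[x00 x11].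
have {x00}x00 : 0 < x by rewrite lt_neqAle eq_sym x0.
have {x11}x11 : x < 1 by rewrite lt_neqAle x1.
have hg : g x = h x by rewrite /g patchE ifT// inE/= in_itv/=; lra.
have [|_ E] := Hx; first by rewrite lte_fin.
rewrite -hg -E derive1E; set F := fun y : R => _.
have Fnear : \near x, f x - f 0 = F x.
  near=> y.
  have y0 : 0 <= y by apply/ltW; near: y; exact: lt_nbhsr.
  have y1 : y <= 1 by apply/ltW; near: y; exact: lt_nbhsl.
  rewrite -(weak_derivative_primitive cf mh ih fh)// /F; apply: eq_Rintegral => z.
  rewrite inE/= in_itv/= => z0y; rewrite /g patchE ifT// inE/= in_itv/=; lra.
have d1 : is_derive x (1 : R) (fun y => f y - f 0) (derive1 f x + 0).
  exact: is_derive1D (smooth_is_derive sf x) (is_derive_cst _ _ _).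
rewrite addr0 in d1.
by have d2 := near_eq_is_derive Fnear d1; apply: derive_val.
Unshelve. all: by end_near. Qed.

Lemma b_family_source_integrable b f fx : continuous f -> L2_S fx ->
  measurable_fun setT (fun y => b / 2 * f y ^+ 2 + (3 - b) / 2 * fx y ^+ 2) /\
  mu.-integrable I (EFin \o (fun y => b / 2 * f y ^+ 2 + (3 - b) / 2 * fx y ^+ 2)).
Proof.
move=> cf [pfx mfx L2fx].
have mf := continuous_measurable_fun cf.
have m1 : measurable_fun setT (fun y => b / 2 * f y ^+ 2).
  by apply: measurable_funM; [exact: measurable_cst|exact: measurable_funX].
have m2 : measurable_fun setT (fun y => (3 - b) / 2 * fx y ^+ 2).
  by apply: measurable_funM; [exact: measurable_cst|exact: measurable_funX].
split; first exact: measurable_funD.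
have i1 : mu.-integrable I (EFin \o (fun y => b / 2 * f y ^+ 2)).
  apply: continuous_integrable => x; apply: cvgMr.
  by apply: (continuous_mul cf cf).
have i2 : mu.-integrable I (EFin \o (fun y => (3 - b) / 2 * fx y ^+ 2)).
  by have := integrableZl _ ((3 - b) / 2) (L2_sqr_integrable mfx L2fx); apply.
exact: integrableD i1 i2.
Qed.

(** Both the transport term [f * f'] and the nonlocal term have mean zero. *)
Lemma b_family_mean_zero b f ft : continuous f -> periodic f 1 ->
  measurable_fun setT ft -> b_family_eq b f ft -> \int[mu]_(x in I) ft x = 0.
Proof.
move=> cf pf mft [fx [L2fx wf fE]].
have [mg ig] := b_family_source_integrable b cf L2fx.
have [pfx mfx L2n] := L2fx.
have ifx := L2_integrable mfx L2n.
have [iD D0] := Rintegral_dx_helmholtz_inv mg ig.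
set D := dx_helmholtz_inv _ in iD D0 fE.
have [M fM] := @continuous_bounded_itv R 0 1 f ler01 cf.
have mffx : measurable_fun setT (fun x => f x * fx x).
  by apply: measurable_funM => //; exact: continuous_measurable_fun.
have iffx : mu.-integrable I (EFin \o (fun x => f x * fx x)).
  have iMh : mu.-integrable I (EFin \o (fun x => M * fx x)).
    by have := integrableZl _ M ifx; apply.
  apply: (le_integrable _ _ _ iMh) => //.
    by apply/measurable_EFinP; apply: measurable_funTS.
  move=> x xI /=; rewrite lee_fin !normrM ler_wpM2r//.
  by apply: le_trans (fM _ xI) (ler_norm _).
transitivity (\int[mu]_(x in I) (- (f x * fx x + D x))).
  congr fine; apply: ae_eq_integral => //.
  - by apply/measurable_EFinP; exact: measurable_funTS.
  - apply/measurable_EFinP; apply: measurable_funN; apply: measurable_funD.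
      exact: measurable_funTS.
    by apply/measurable_EFinP; case/integrableP: iD.
  - move: fE; apply: negligibleS => x /= H E; apply: H => _.
    by congr (_%:E); lra.
rewrite RintegralN//; last exact: integrableD iffx iD.
rewrite RintegralD// D0 addr0.
by rewrite (Rintegral_mul_weak_derivative cf pf mfx ifx wf) oppr0.
Qed.

(** A norm dominating the mean turns differentiability of u in that norm into
    differentiability of its mean. *)
Lemma is_derive_mean (N : (R -> R) -> \bar R) (u ut : R -> R -> R) t (T : R) :
  (forall v, measurable_fun setT v -> (`|\int[mu]_(x in I) v x|%:E <= N v)%E) ->
  t \in `]- T, T[ ->
  (forall s, s \in `]- T, T[ -> measurable_fun setT (u s) /\ mu.-integrable I (EFin \o u s)) ->
  measurable_fun setT (ut t) -> mu.-integrable I (EFin \o ut t) ->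
  derivative_in N u t (ut t) ->
  is_derive t (1 : R) (fun s => \int[mu]_(x in I) u s x) (\int[mu]_(x in I) ut t x).
Proof.
move=> Nmean tT mu_ mut iut dN.
have [mut0 iut0] := mu_ t tT.
pose M s := \int[mu]_(x in I) u s x.
suff H : (fun h : R => h^-1 *: ((M \o shift t) (h *: (1 : R)) - M t)) @ 0^' --> \int[mu]_(x in I) ut t x.
  apply: DeriveDef; first by apply/cvg_ex; exists (\int[mu]_(x in I) ut t x).
  by apply/cvg_lim => //; exact: Rhausdorff.
apply/cvgrPdist_le => e e0.
have : \forall h \near (0 : R)^', (N (fun x => h^-1 * (u (t + h) x - u t x) - ut t x)%R < e%:E)%E.
  apply: (dN [set z | (z < e%:E)%E]); apply: open_nbhs_nbhs; split.
    exact: open_ereal_lt_ereal.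
  by rewrite /= lte_fin.
have d0 : 0 < Num.min (t + T) (T - t).
  by move: tT; rewrite in_itv/= lt_min; lra.
move=> Ne; near=> h.
have hT : t + h \in `]- T, T[.
  have : `|h| < Num.min (t + T) (T - t) by near: h; exact: dnbhs0_lt.
  by rewrite lt_min in_itv/= !ltr_norml; lra.
have [mh ih] := mu_ _ hT.
have Ih : h^-1 * (M (t + h) - M t) - \int[mu]_(x in I) ut t x =
    \int[mu]_(x in I) (h^-1 * (u (t + h) x - u t x) - ut t x).
  have i1 : mu.-integrable I (EFin \o (fun x => u (t + h) x - u t x)).
    exact: integrableB ih iut0.
  have i2 : mu.-integrable I (EFin \o (fun x => h^-1 * (u (t + h) x - u t x))).
    by have := integrableZl _ h^-1 i1; apply.
  by rewrite RintegralB// RintegralZl// RintegralB.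
rewrite distrC /= /GRing.scale /= mulr1 [h + t]addrC Ih -lee_fin.
apply: le_trans (Nmean _ _) _.
  apply: measurable_funB => //; apply: measurable_funM => //.
  exact: measurable_funB.
by apply/ltW; near: h.
Unshelve. all: by end_near. Qed.

End MeanConservation.

(** * Conservation of the mean and the gap of the source *)

Section Construction.
Context {R : realType}.
Local Notation mu := (@lebesgue_measure R).
Implicit Types (f g h v : R -> R) (x y z t : R).
Local Notation I := (`[0, 1]%classic : set R).

(** Solutions of either class are differentiable in time in a norm dominating the
    mean, and their time derivative has mean zero. *)
Lemma mean_conserved (b T : R) (u0 : R -> R) (u ut : R -> R -> R) : 0 < T ->
  b_family_solution b T u0 u ut -> forall t, t \in `]- T, T[ ->
  \int[mu]_(x in I) u t x = \int[mu]_(x in I) u0 x.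
Proof.
move=> T0 [cl cu u00 eqn].
have oc t : t \in `]- T, T[ -> t \in `[- T, T] by exact: subset_itv_oo_cc.
have [N [Nmean [Lu [Lut dN]]]] : exists N : (R -> R) -> \bar R,
    (forall v, measurable_fun setT v -> (`|\int[mu]_(x in I) v x|%:E <= N v)%E) /\
    (forall t, t \in `]- T, T[ -> L2_S (u t)) /\
    (forall t, t \in `]- T, T[ -> L2_S (ut t)) /\
    (forall t, t \in `]- T, T[ -> derivative_in N u t (ut t)).
  case: cl => [[s s32 [E1 _ E0 _]]|[[E1 _ E0 _] _]].
    exists (sobolev_norm (s - 1)); split; first by move=> v _; exact: mean_le_sobolev_norm.
    split; first by move=> t /oc/E1[].
    by split=> t /E0[] => [[]|].
  exists L2_norm; split; first by move=> v; exact: mean_le_L2_norm.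
  split; first by move=> t /oc/E1[].
  by split=> t /E0[].
have L2i v : L2_S v -> measurable_fun setT v /\ mu.-integrable I (EFin \o v).
  by move=> [_ mv Lv]; split => //; exact: L2_integrable.
pose m t := \int[mu]_(x in I) u t x.
have dM t : t \in `]- T, T[ -> is_derive t (1 : R) m 0.
  move=> tT; have [mut iut] := L2i _ (Lut t tT).
  have [pu _ _] := Lu t tT.
  have Z := b_family_mean_zero (cu t (oc t tT)) pu mut (eqn t tT).
  have uL s : s \in `]- T, T[ -> measurable_fun setT (u s) /\ mu.-integrable I (EFin \o u s).
    by move=> /Lu/L2i.
  by have := is_derive_mean Nmean tT uL mut iut (dN t tT) => /is_derive_eq; apply.
have T0T : 0 \in `]- T, T[ by rewrite in_itv/=; lra.
have cst x y : x \in `]- T, T[ -> y \in `]- T, T[ -> x <= y ->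
    m y = m x.
  move=> xT yT xy.
  have xyT z : z \in `[x, y] -> z \in `]- T, T[.
    by move: xT yT; rewrite !in_itv/=; lra.
  have dm z : z \in `]x, y[ -> is_derive z (1 : R) m ((fun=> 0) z).
    by move=> zxy; apply: dM; apply: xyT; exact: subset_itv_oo_cc.
  have cm : {within `[x, y], continuous m}.
    by apply: derivable_within_continuous => z zxy; apply: ex_derive; apply: dM; exact: xyT.
  have [c _] := MVT_segment xy dm cm.
  by rewrite mul0r => /eqP; rewrite subr_eq0 => /eqP.
have -> : u0 = u 0 by apply/funext => x; rewrite u00.
by move=> t tT; have [t0|t0] := leP t 0; [apply/esym|]; apply: cst => //; exact: ltW.
Qed.

Lemma continuous_periodic_bounded f : continuous f -> periodic f 1 ->
  exists M, forall x, `|f x| <= M.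
Proof.
move=> cf pf; have [M fM] := @continuous_bounded_itv R 0 1 f ler01 cf.
exists M => x; rewrite -(periodic_int (- Num.floor x) x pf) fM// in_itv/=.
by have := floor_itv x; rewrite intrD mulrNz; lra.
Qed.

(** Both sides solve the same second order equation in x and agree at x = a and
    x = b; expanding exponentials proves it. *)
Lemma sinh_interpolation (a b x w : R) :
  Defs.sinh (b - a) * Defs.sinh (x + w) =
  Defs.sinh (b - x) * Defs.sinh (a + w) + Defs.sinh (x - a) * Defs.sinh (b + w).
Proof.
rewrite /Defs.sinh !opprB !opprD !expRD !expRN.
have n z : expR z != 0 by rewrite gt_eqF// expR_gt0.
by field; rewrite !n.
Qed.

(** Seen from a point y off the gap, the gap contains no jump of the kernel: n is 0
    for y to the left of it and -1 for y to the right. *)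
Lemma gap_same_branch (a b y : R) : 0 < a -> b < 1 -> y \in `[0, 1] ->
  y \notin `[a, b] ->
  exists n : int, forall z, a <= z <= b -> n%:~R <= z - y < n%:~R + 1.
Proof.
move=> a0 b1; rewrite !in_itv/= negb_and -!ltNge => y01 /orP[ya|yb].
  by exists 0 => z zab; lra.
by exists (-1) => z zab; rewrite mulrN1z; lra.
Qed.

(** Outside the support of the source the nonlocal term solves [D'' = D], so
    it is determined by its values at the two ends of the gap. *)
Lemma dx_helmholtz_inv_gap (a b : R) g (M : R) : 0 < a -> a < b -> b < 1 ->
  measurable_fun setT g -> (forall x, `|g x| <= M) ->
  (forall y, y \in `[a, b] -> g y = 0) ->
  forall x, x \in `[a, b] ->
  Defs.sinh (b - a) * dx_helmholtz_inv g x =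
  Defs.sinh (b - x) * dx_helmholtz_inv g a + Defs.sinh (x - a) * dx_helmholtz_inv g b.
Proof.
move=> a0 ab b1 mg gM gab x; rewrite in_itv/= => xab.
have ik z := integrable_kern_mul z mg gM.
have iZ (c z : R) : mu.-integrable I (EFin \o (fun y => c * (kern (z - y) * g y))).
  by have := integrableZl _ c (ik z); apply.
have DE (c z : R) : c * dx_helmholtz_inv g z = \int[mu]_(y in I) (c * (kern (z - y) * g y)).
  by rewrite RintegralZl//; exact: ik.
rewrite !DE -RintegralD//.
apply: eq_Rintegral => y; rewrite inE/= => y01.
have [yab|yab] := boolP (y \in `[a, b]); first by rewrite gab// !mulr0 addr0.
have [n nE] := gap_same_branch a0 b1 y01 yab.
have kE z : a <= z <= b -> kern (z - y) = Defs.sinh (z + (- y - n%:~R - 2^-1)) / (2 * Defs.sinh 2^-1).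
  by move=> /nE/kern_floor ->; congr (Defs.sinh _ / _); lra.
rewrite !kE ?lexx ?(ltW ab)//.
move: (- y - n%:~R - 2^-1) => w; have := sinh_interpolation a b x w.
rewrite ![_ / (2 * Defs.sinh 2^-1)]mulrC; move: (2 * Defs.sinh 2^-1)^-1 => k.
move: (Defs.sinh (x + w)) (Defs.sinh (a + w)) (Defs.sinh (b + w)) => s1 s2 s3.
move: (Defs.sinh (b - a)) (Defs.sinh (b - x)) (Defs.sinh (x - a)) => c1 c2 c3 E.
have -> : c1 * (k * s1 * g y) = c1 * s1 * k * g y by ring.
rewrite E; ring.
Qed.

(** For y off the gap the points a - y and b - y lie on the same branch of the
    kernel, which is increasing. *)
Lemma kern_increasing (a b y : R) : 0 < a -> a < b -> b < 1 -> y \in `[0, 1] ->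
  y \notin `[a, b] -> kern (a - y) < kern (b - y).
Proof.
move=> a0 ab b1 y01 yab.
have [n nE] := gap_same_branch a0 b1 y01 yab.
rewrite (kern_floor (nE a _)) ?(kern_floor (nE b _)) ?lexx ?(ltW ab)//.
by rewrite ltr_pM2r ?invr_gt0 ?sinh_half_gt0// lt_sinh; lra.
Qed.

End Construction.

(** * The initial datum *)

Section Datum.
Context {R : realType}.
Local Notation mu := (@lebesgue_measure R).
Implicit Types (f g h p : R -> R) (a b x y z : R).
Local Notation I := (`[0, 1]%classic : set R).

(** Integrating g against this function compares the values of the nonlocal term
    at the two ends of the gap. *)
Definition kern_gap (a b y : R) : R := kern (b - y) - kern (a - y).

Lemma integrable_kern_gap a b g (M : R) : measurable_fun setT g ->
  (forall x, `|g x| <= M) -> mu.-integrable I (EFin \o (fun y => kern_gap a b y * g y)).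
Proof.
move=> mg gM; have := integrableB _ (integrable_kern_mul b mg gM) (integrable_kern_mul a mg gM).
move=> /(_ (measurable_itv _)); apply: eq_integrable => // y _ /=.
by rewrite -EFinB /kern_gap mulrBl.
Qed.

Lemma Rintegral_kern_gap a b g (M : R) : measurable_fun setT g ->
  (forall x, `|g x| <= M) ->
  \int[mu]_(y in I) (kern_gap a b y * g y) = dx_helmholtz_inv g b - dx_helmholtz_inv g a.
Proof.
move=> mg gM; rewrite /dx_helmholtz_inv -RintegralB//;
  [|exact: integrable_kern_mul gM|exact: integrable_kern_mul gM].
by apply: eq_Rintegral => y _; rewrite /kern_gap mulrBl.
Qed.

Lemma Rintegral_kern_gap_gt0 a b p (M : R) : 0 < a -> a < b -> b < 1 ->
  measurable_fun setT p -> (forall x, `|p x| <= M) -> (forall y, 0 <= p y) ->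
  (forall y, y \in `[a, b] -> p y = 0) -> (forall y, y \in `]b, 1[ -> 0 < p y) ->
  0 < \int[mu]_(y in I) (kern_gap a b y * p y).
Proof.
move=> a0 ab b1 mp pM p0 pab ppos.
apply: (@Rintegral_gt0 _ 0 1 b 1) => //; first by lra.
- exact: integrable_kern_gap pM.
- move=> y y01; have [yab|yab] := boolP (y \in `[a, b]); first by rewrite pab// mulr0.
  by rewrite mulr_ge0// subr_ge0 ltW// kern_increasing.
- move=> y yb1; rewrite mulr_gt0 ?ppos// subr_gt0 kern_increasing//.
    by move: yb1; rewrite !in_itv/=; lra.
  by move: yb1; rewrite !in_itv/= negb_and -!ltNge; lra.
Qed.

Lemma dx_helmholtz_inv_add_cst (c : R) g (M : R) x : measurable_fun setT g ->
  (forall z, `|g z| <= M) ->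
  dx_helmholtz_inv (fun y => c + g y) x = dx_helmholtz_inv g x.
Proof.
move=> mg gM.
have ic : mu.-integrable I (EFin \o (fun y => kern (x - y) * c)).
  by apply: (integrable_kern_mul x (g := fun=> c) (M := `|c|)) => //; exact: measurable_cst.
have -> : dx_helmholtz_inv (fun y => c + g y) x =
    \int[mu]_(y in I) (kern (x - y) * c + kern (x - y) * g y).
  by apply: eq_Rintegral => y _; rewrite -mulrDr.
rewrite RintegralD//; last exact: integrable_kern_mul gM.
rewrite RintegralZr// ?Rintegral_kern_r ?mul0r ?add0r//.
apply: (@bounded_integrable_itv _ _ 1); first exact: measurable_kern_shift.
by move=> y; exact: kern_bounded.
Qed.

(** By symmetry the nonlocal term is odd about the midpoint of the gap, so it
    takes opposite values at the ends; the balance condition makes them equal. *)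
Lemma dx_helmholtz_inv_balanced a b g (M : R) : 0 < a -> a < b -> b < 1 ->
  measurable_fun setT g -> (forall x, `|g x| <= M) -> periodic g 1 ->
  (forall y, y \in `[a, b] -> g y = 0) -> (forall y, g (b + (a + 1) - y) = g y) ->
  \int[mu]_(y in I) (kern_gap a b y * g y) = 0 ->
  forall x, x \in `[a, b] -> dx_helmholtz_inv g x = 0.
Proof.
move=> a0 ab b1 mg gM pg gab sg bal x xab.
have s_neq0 : Defs.sinh (b - a) != 0 by rewrite gt_eqF// sinh_gt0// subr_gt0.
have Dab : dx_helmholtz_inv g b = dx_helmholtz_inv g a.
  by apply/eqP; rewrite -subr_eq0 -(Rintegral_kern_gap a b mg gM) bal.
have Da : dx_helmholtz_inv g a = - dx_helmholtz_inv g b.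
  apply: etrans (esym (dx_helmholtz_inv_periodic g a)) _.
  apply: etrans _ (dx_helmholtz_inv_reflect b mg gM pg sg).
  by congr (dx_helmholtz_inv g _); ring.
have zero (p q : R) : q = p -> p = - q -> p = 0 by clear; lra.
have Da0 := zero _ _ Dab Da; have Db0 := etrans Dab Da0; clear zero Dab Da.
apply: (mulfI s_neq0); rewrite mulr0.
apply: (etrans (dx_helmholtz_inv_gap a0 ab b1 mg gM gab xab)).
rewrite Da0 Db0 !mulr0; exact: addr0.
Qed.

Lemma dhump_reflect a b x : dhump a b (a + b - x) = - dhump a b x.
Proof.
rewrite /dhump.
have -> : pi * (a + b - 2 * (a + b - x)) = - (pi * (a + b - 2 * x)) by ring.
by rewrite sinN mulrN.
Qed.

(** The amplitude [lam] of the perturbation solves the balance condition, which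
    is [lam * (lam * B - b * c0 * A) = 0] with [A, B > 0]. *)
Lemma exists_balanced_amplitude (b c0 al be : R) : 0 < b <= 3 -> c0 != 0 ->
  0 < al -> al < be -> be < 1 ->
  exists2 lam : R, lam != 0 & forall x, x \in `[al, be] ->
    dx_helmholtz_inv (fun y => b / 2 * (c0 - lam * arc_bump be (al + 1) 1 y) ^+ 2 +
      (3 - b) / 2 * (- lam * arc_dbump be (al + 1) 1 y) ^+ 2) x = 0.
Proof.
move=> b03 c00 al0 ab be1.
set psi := arc_bump be (al + 1) 1; set dpsi := arc_dbump be (al + 1) 1.
have smooth_psi : smooth_S psi by exact: bump_smooth.
have cpsi : continuous psi := smooth_continuous smooth_psi.
have cdpsi : continuous dpsi by exact: continuous_dbump.
have hump_gap y : y \in `[al, be] -> hump be (al + 1) y <= 0.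
  by rewrite in_itv/= => yab; apply: hump_le0l; lra.
have psi0 y : y \in `[al, be] -> psi y = 0 by move=> /hump_gap; exact: bump_eq0.
have dpsi0 y : y \in `[al, be] -> dpsi y = 0 by move=> /hump_gap; exact: dbump_eq0.
have psi_gt0 y : y \in `]be, 1[ -> 0 < psi y.
  by rewrite in_itv/= => yb; apply: bump_gt0 => //; apply: hump_gt0; lra.
have pdpsi : periodic dpsi 1.
  by rewrite /dpsi -derive1_bump; exact: (smooth_derive1 smooth_psi).1.
have psi_sym y : psi (be + (al + 1) - y) = psi y by rewrite /psi /arc_bump hump_reflect.
have dpsi_sym y : dpsi (be + (al + 1) - y) = - dpsi y.
  by rewrite /dpsi /arc_dbump hump_reflect dhump_reflect !mulrN.
pose Q y := b / 2 * psi y ^+ 2 + (3 - b) / 2 * dpsi y ^+ 2.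
have cQ : continuous Q.
  move=> y; apply: cvgD; apply: cvgMr.
    exact: (continuous_mul cpsi cpsi).
  exact: (continuous_mul cdpsi cdpsi).
have pQ : periodic Q 1 by move=> y; rewrite /Q smooth_psi.1 pdpsi.
have [MQ QM] := continuous_periodic_bounded cQ pQ.
have psiM y : `|psi y| <= 1 by rewrite ger0_norm ?bump_ge0// bump_le1.
have mpsi := continuous_measurable_fun cpsi.
have mQ := continuous_measurable_fun cQ.
pose A := \int[mu]_(y in I) (kern_gap al be y * psi y).
pose B := \int[mu]_(y in I) (kern_gap al be y * Q y).
have A0 : 0 < A.
  by apply: (Rintegral_kern_gap_gt0 al0 ab be1 mpsi psiM) => // y; exact: bump_ge0.
have B0 : 0 < B.
  apply: (Rintegral_kern_gap_gt0 al0 ab be1 mQ QM).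
  - by move=> y; rewrite addr_ge0// mulr_ge0 ?sqr_ge0//; lra.
  - by move=> y yab; rewrite /Q psi0// dpsi0// expr0n !mulr0 addr0.
  - move=> y /psi_gt0 py; rewrite ltr_pwDl//; last by rewrite mulr_ge0 ?sqr_ge0//; lra.
    by rewrite mulr_gt0 ?exprn_gt0//; lra.
(* the nonzero root of lam * (lam * B - b * c0 * A) *)
pose lam := b * c0 * A / B.
have lam0 : lam != 0.
  by have /andP[b0 _] := b03; rewrite !mulf_neq0 ?invr_eq0// gt_eqF.
exists lam => // x xab.
pose G y := lam * (lam * Q y - b * c0 * psi y).
have -> : (fun y => b / 2 * (c0 - lam * psi y) ^+ 2 + (3 - b) / 2 * (- lam * dpsi y) ^+ 2)
    = (fun y => b / 2 * c0 ^+ 2 + G y).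
  by apply/funext => y; rewrite /G /Q; field.
have cG : continuous G.
  move=> y; apply: cvgMr; apply: cvgB; apply: cvgMr; [exact: cQ|exact: cpsi].
have pG : periodic G 1 by move=> y; rewrite /G pQ smooth_psi.1.
have [MG GM] := continuous_periodic_bounded cG pG.
have mG := continuous_measurable_fun cG.
rewrite (dx_helmholtz_inv_add_cst _ _ mG GM).
apply: (dx_helmholtz_inv_balanced al0 ab be1 mG GM pG) => //.
- by move=> y yab; rewrite /G /Q psi0// dpsi0//; ring.
- by move=> y; rewrite /G /Q psi_sym dpsi_sym sqrrN.
have iQ := integrable_kern_gap al be mQ QM.
have ipsi := integrable_kern_gap al be mpsi psiM.
transitivity (\int[mu]_(y in I) (lam ^+ 2 * (kern_gap al be y * Q y) -
    lam * b * c0 * (kern_gap al be y * psi y))).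
  by apply: eq_Rintegral => y _; rewrite /G; ring.
rewrite RintegralB//; last 2 first.
- by have := integrableZl _ (lam ^+ 2) iQ; apply.
- by have := integrableZl _ (lam * b * c0) ipsi; apply.
rewrite !RintegralZl// -/A -/B /lam; field.
by rewrite gt_eqF.
Qed.

End Datum.

Theorem theorem1p5 (R : realType) (b : R) (hb : 0 < b <= 3)
    (c0 : R) (hc0 : c0 != 0)
    (alpha beta : R) (halpha : 0 < alpha < 1) (hbeta : 0 < beta < 1)
    (hab : alpha < beta) :
  exists u0 : R -> R,
    [/\ smooth_S u0,
        ~ (forall x, u0 x = c0),
        forall x, x \in `[alpha, beta] -> u0 x = c0 &
        forall (T : R) (u ut : R -> R -> R),
          0 < T -> b_family_solution b T u0 u ut ->
          (exists w : R -> R,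
            [/\ periodic w 1, continuous w,
                {ae @lebesgue_measure R, forall x, w x = ut 0 x} &
                forall x, x \in `[alpha, beta] -> w x = 0]) /\
          (forall t, t \in `]- T, T[ -> ~ (forall x, u t x = c0))].
Proof.
have /andP[al0 al1] := halpha; have /andP[be0 be1] := hbeta.
have [lam lam0 Dlam] := exists_balanced_amplitude hb hc0 al0 hab be1.
set psi := arc_bump beta (alpha + 1) 1 in Dlam; set dpsi := arc_dbump beta (alpha + 1) 1 in Dlam.
pose u0 x := c0 - lam * psi x; pose du0 x := - lam * dpsi x.
have smooth_psi : smooth_S psi by exact: bump_smooth.
have hump_gap y : y \in `[alpha, beta] -> hump beta (alpha + 1) y <= 0.
  by rewrite in_itv/= => yab; apply: hump_le0l; lra.
have psi0 y : y \in `[alpha, beta] -> psi y = 0 by move=> /hump_gap; exact: bump_eq0.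
have dpsi0 y : y \in `[alpha, beta] -> dpsi y = 0 by move=> /hump_gap; exact: dbump_eq0.
have psi_gt0 y : y \in `]beta, 1[ -> 0 < psi y.
  by rewrite in_itv/= => yb; apply: bump_gt0 => //; apply: hump_gt0; lra.
have smooth_u0 : smooth_S u0.
  apply: derivable_upto_smooth; first by move=> x; rewrite /u0 smooth_psi.1.
  move=> n; rewrite (_ : u0 = (fun x => (fun z => - lam * z + c0) (psi x))); last first.
    by apply/funext => x; rewrite /u0; ring.
  apply: (derivable_upto_comp (f := fun z => - lam * z + c0)).
    exact: derivable_upto_affine.
  exact: derivable_upto_bump.
have du0E : derive1 u0 = du0.
  apply/funext => x; rewrite derive1E; apply: derive_val.
  have dl : is_derive x (1 : R) (fun z => - lam * psi z) (0 * psi x + - lam * dpsi x).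
    by apply: is_derive1M; exact: is_derive_bump.
  have := is_derive1D (is_derive_cst c0 x (1 : R)) dl.
  rewrite mul0r !add0r (_ : (fun y => _) = u0)//.
  by apply/funext => y; rewrite /u0 mulNr.
have cu0 := smooth_continuous smooth_u0.
have sdu0 := smooth_derive1 smooth_u0; rewrite du0E in sdu0.
have cdu0 := smooth_continuous sdu0.
exists u0; split => //.
- move=> /(_ ((beta + 1) / 2)) /eqP; rewrite /u0 -subr_eq0 addrAC subrr add0r oppr_eq0.
  by rewrite mulf_eq0 (negbTE lam0)/= gt_eqF// psi_gt0// in_itv/=; lra.
- by move=> x xab; rewrite /u0 psi0// mulr0 subr0.
move=> T u ut T0 sol; split; last first.
  move=> t tT utc; have := mean_conserved T0 sol tT.
  have -> : \int[lebesgue_measure]_(x in `[0, 1]) u t x = \int[lebesgue_measure]_(x in `[0, 1]) (cst c0 x).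
    by apply: eq_Rintegral => x _; rewrite utc.
  have ipsi := continuous_integrable 0 1 (smooth_continuous smooth_psi).
  rewrite RintegralB//; last 2 first.
  - by apply: continuous_integrable => x; exact: cvg_cst.
  - by have := integrableZl _ lam ipsi; apply.
  rewrite RintegralZl// => /eqP; rewrite -subr_eq0 opprB addrC subrK mulf_eq0 (negbTE lam0)/=.
  rewrite gt_eqF//; apply: (@Rintegral_gt0 _ 0 1 beta 1) => //; first exact: ltW.
  by move=> x _; exact: bump_ge0.
have [_ _ u00 eqn] := sol.
have u0E : u 0 = u0 by apply/funext.
have T0T : 0 \in `]- T, T[ by rewrite in_itv/=; lra.
have := eqn 0 T0T; rewrite u0E => -[fx [L2fx wfx fxE]].
have [pfx mfx L2n] := L2fx.
have fx_ae := weak_derivative_smooth_ae smooth_u0 mfx pfx (L2_integrable mfx L2n) wfx.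
rewrite du0E in fx_ae.
pose g y := b / 2 * u0 y ^+ 2 + (3 - b) / 2 * du0 y ^+ 2.
have cg : continuous g.
  move=> y; apply: cvgD; apply: cvgMr.
    exact: (continuous_mul cu0 cu0).
  exact: (continuous_mul cdu0 cdu0).
have pg : periodic g 1 by move=> y; rewrite /g smooth_u0.1 sdu0.1.
have [M gM] := continuous_periodic_bounded cg pg.
have mg := continuous_measurable_fun cg.
have Dg x : dx_helmholtz_inv (fun y => b / 2 * u0 y ^+ 2 + (3 - b) / 2 * fx y ^+ 2) x =
    dx_helmholtz_inv g x.
  have [mgx _] := b_family_source_integrable b cu0 L2fx.
  congr fine; apply: ae_eq_integral => //.
  - by apply/measurable_EFinP; apply: measurable_funTS; exact: measurable_kern_mul.
  - by apply/measurable_EFinP; apply: measurable_funTS; exact: measurable_kern_mul.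
  - by move: fx_ae; apply: negligibleS => y /= H E; apply: H => _; rewrite /g E.
exists (fun x => - (u0 x * du0 x + dx_helmholtz_inv g x)); split.
- by move=> x; rewrite smooth_u0.1 sdu0.1 dx_helmholtz_inv_periodic.
- move=> x; apply: cvgN; apply: cvgD; first exact: (continuous_mul cu0 cdu0).
  exact: (continuous_dx_helmholtz_inv mg gM).
- have := negligibleU fx_ae fxE; apply: negligibleS => x /= H.
  apply/not_andP => -[E1 E2]; apply: H; move: E2; rewrite Dg E1; lra.
- by move=> x xab; rewrite /du0 dpsi0// !mulr0 add0r Dlam// oppr0.
Qed.
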